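(* If $\Omega$ is a bounded and strictly convex domain and $f\in C(\overline\Omega)$, then the discrete solution $u_\varepsilon$ of $$T_\varepsilon[u_\varepsilon;f](x_i)=0\quad\forall x_i\in\mathcal N_h^0,\qquad u_\varepsilon(x_i)=f(x_i)\quad\forall x_i\in\mathcal N_h^b$$ converges uniformly to the convex envelope $u$ of $f$ as $\varepsilon=(h,\delta,\theta)\to0$ and $\frac h\delta\to0$; that is, $\|u_\varepsilon-u\|_{L^\infty(\Omega_h)}\to0$.
   Context: $\Omega\subset\mathbb R^d$ is open. The convex envelope of $f$ is $u(x)=\sup\{l(x): l\le f\text{ in }\overline\Omega,\ l\text{ affine}\}$ for $x\in\overline\Omega$. $\{\mathcal T_h\}$ is a sequence of shape-regular, quasi-uniform (uniformly in $h$) conforming meshes of closed simplices $T$ with mesh size $h$. $\Omega_h$ is the interior of the union of the elements $T\in\mathcal T_h$; $\mathcal N_h$ is the set of nodes (vertices) of $\mathcal T_h$, $\mathcal N_h^b:=\{x_i\in\mathcal N_h: x_i\in\partial\Omega\}$ and $\mathcal N_h^0:=\mathcal N_h\setminus\mathcal N_h^b$. The nodes lying on $\partial\Omega_h$ are required to lie on $\partial\Omega$, and $\Omega_h\subset\Omega$ is convex. $\mathbb V_h$ is the space of continuous piecewise linear functions over $\mathcal T_h$. $\mathbb S$ is the unit sphere of $\mathbb R^d$, and $\mathbb S_\theta\subset\mathbb S$ is a finite set such that for every $v\in\mathbb S$ there is $v^\theta\in\mathbb S_\theta$ with $|v-v^\theta|\le\theta$. The coarse scale is $\delta\ge h$,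 and for $x_i\in\mathcal N_h^0$, $\delta_i:=\min\{\delta,\mathrm{dist}(x_i,\partial\Omega_h)\}$. For $w\in C(\overline{\Omega}_h)$, $x_i\in\mathcal N_h^0$, $v\in\mathbb S$, $$\nabla^2_\delta w(x_i;v):=\frac{w(x_i+\delta_i v)-2w(x_i)+w(x_i-\delta_i v)}{\delta_i^2}.$$ For $w_h\in\mathbb V_h$ and $x_i\in\mathcal N_h^0$, $$T_\varepsilon[w_h;f](x_i):=\min\Big\{f(x_i)-w_h(x_i),\ \min_{v\in\mathbb S_\theta}\nabla^2_\delta w_h(x_i;v)\Big\}.$$ The discrete problem has a unique solution $u_\varepsilon\in\mathbb V_h$ for all parameters. *)

(* Defs.v *)
From HB Require Import structures.
From mathcomp Require Import all_boot all_order all_algebra.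
From mathcomp Require Import all_classical all_reals all_analysis.

Set Implicit Arguments.
Unset Strict Implicit.
Unset Printing Implicit Defensive.

Import Order.TTheory GRing.Theory Num.Theory.
Import numFieldNormedType.Exports.

Local Open Scope classical_set_scope.
Local Open Scope ring_scope.

(* R^d is 'rV[R]_d.  Its library norm is the sup norm: same topology and same
   bounded sets as the Euclidean norm, but every quantity below that involves
   lengths (unit sphere, distances, diameters) is Euclidean. *)

Section Euclidean.
Variables (R : realType) (d : nat).
Implicit Types (A : set 'rV[R]_d) (x y v : 'rV[R]_d).

Definition enorm x : R := Num.sqrt (\sum_(i < d) x 0 i ^+ 2).

Definition unit_sphere : set 'rV[R]_d := [set v | enorm v = 1].

Definition euclid_dist x A : R := inf [set enorm (x - y) | y in A].

Definition diam A : R := sup [set enorm (p.1 - p.2) | p in A `*` A].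

Definition inradius A : R :=
  sup [set r | 0 <= r /\
    exists c, [set y | enorm (y - c) <= r] `<=` A].

Definition boundary A := closure A `\` A°.

(* For open A.  Taking t x + (1 - t) y in A itself makes A convex and
   excludes segments in the boundary of A. *)
Definition strictly_convex A :=
  forall x y, closure A x -> closure A y -> x != y ->
  forall t : R, 0 < t < 1 -> A (t *: x + (1 - t) *: y).

Definition affine (l : 'rV[R]_d -> R) :=
  exists (p : 'rV[R]_d) (c : R), forall x, l x = \sum_(i < d) p 0 i * x 0 i + c.

Definition convex_envelope (Omega : set 'rV[R]_d) (f : 'rV[R]_d -> R) x : R :=
  sup [set l x | l in
    [set l | affine l /\ forall y, closure Omega y -> l y <= f y]].

(* Supremum of |g| over A, in the extended reals.  For g continuous on an open
   set A this is the L^oo(A) norm with respect to Lebesgue measure. *)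
Definition Linfty_norm A (g : 'rV[R]_d -> R) : \bar R :=
  ereal_sup [set `|g x|%:E | x in A].

End Euclidean.

Section Mesh.
Variables (R : realType) (d : nat).

(* Convex hull of the points p i, i in s. *)
Definition hull n (p : 'I_n -> 'rV[R]_d) (s : {set 'I_n}) : set 'rV[R]_d :=
  [set x | exists a : 'I_n -> R,
    [/\ forall i, 0 <= a i, \sum_(i in s) a i = 1
      & x = \sum_(i in s) a i *: p i]].

Definition affinely_independent n (p : 'I_n -> 'rV[R]_d) (s : {set 'I_n}) :=
  forall a : 'I_n -> R,
    \sum_(i in s) a i = 0 -> \sum_(i in s) a i *: p i = 0 ->
    forall i, i \in s -> a i = 0.

(* A conforming simplicial mesh: the nodes are numbered, and an element is
   given by the set of indices of its d + 1 vertices.  In mesh_conforming, the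
   right-hand side is the common face spanned by the shared vertices (the
   empty set if there are none). *)
Record mesh := Mesh {
  mesh_card : nat;
  node : 'I_mesh_card -> 'rV[R]_d;
  elements : {set {set 'I_mesh_card}};
  node_inj : injective node;
  elements_neq0 : elements != finset.set0;
  node_in_element : forall i, exists2 s, s \in elements & i \in s;
  card_element : forall s, s \in elements -> #|s| = d.+1;
  element_affinely_independent : forall s, s \in elements ->
    affinely_independent node s;
  mesh_conforming : forall s t, s \in elements -> t \in elements ->
    hull node s `&` hull node t = hull node (s :&: t)%SET }.

Variable T : mesh.

Definition simplex (s : {set 'I_(mesh_card T)}) := hull (@node T) s.

Definition mesh_domain : set 'rV[R]_d :=
  (\bigcup_(s in [set s | s \in elements T]) simplex s)°.

Definition mesh_size : R := \big[Num.max/0]_(s in elements T) diam (simplex s).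

Definition piecewise_linear (w : 'rV[R]_d -> R) :=
  {within closure mesh_domain, continuous w} /\
  forall s, s \in elements T ->
    exists2 l, affine l & forall x, simplex s x -> w x = l x.

(* The index i stands for the node x_i. *)
Definition boundary_node (Omega : set 'rV[R]_d) (i : 'I_(mesh_card T)) :=
  boundary Omega (node i).

Definition interior_node (Omega : set 'rV[R]_d) (i : 'I_(mesh_card T)) :=
  ~ boundary_node Omega i.

Definition mesh_of (Omega : set 'rV[R]_d) :=
  [/\ mesh_domain `<=` Omega, convex_set mesh_domain &
      forall i : 'I_(mesh_card T), boundary mesh_domain (node i) -> boundary Omega (node i)].

Definition local_scale (delta : R) (i : 'I_(mesh_card T)) : R :=
  Num.min delta (euclid_dist (node i) (boundary mesh_domain)).

Definition second_diff (delta : R) (w : 'rV[R]_d -> R)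
    (i : 'I_(mesh_card T)) (v : 'rV[R]_d) : R :=
  let x := node i in let di := local_scale delta i in
  (w (x + di *: v) - 2 * w x + w (x - di *: v)) / di ^+ 2.

(* The finite direction set is a sequence Stheta; using f - w as the initial value
   of the iterated minimum gives min{f - w, min_{v in Stheta} second_diff}. *)
Definition two_scale_op (delta : R) (Stheta : seq 'rV[R]_d)
    (w f : 'rV[R]_d -> R) (i : 'I_(mesh_card T)) : R :=
  \big[Num.min/f (node i) - w (node i)]_(v <- Stheta) second_diff delta w i v.

Definition discrete_solution (Omega : set 'rV[R]_d) (f : 'rV[R]_d -> R)
    (delta : R) (Stheta : seq 'rV[R]_d) (w : 'rV[R]_d -> R) :=
  [/\ piecewise_linear w,
      forall i, interior_node Omega i -> two_scale_op delta Stheta w f i = 0 &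
      forall i, boundary_node Omega i -> w (node i) = f (node i)].

End Mesh.

Definition shape_regular (R : realType) (d : nat) (T : nat -> mesh R d) :=
  exists2 sigma : R, 0 < sigma &
    forall k s, s \in elements (T k) ->
      diam (simplex s) <= sigma * inradius (simplex s).

Definition quasi_uniform (R : realType) (d : nat) (T : nat -> mesh R d) :=
  exists2 c : R, 0 < c &
    forall k s, s \in elements (T k) ->
      c * mesh_size (T k) <= diam (simplex s).

Definition direction_net (R : realType) (d : nat) (theta : R)
    (Stheta : seq 'rV[R]_d) :=
  (forall v, v \in Stheta -> unit_sphere v) /\
  (forall v, unit_sphere v -> exists2 w, w \in Stheta & enorm (v - w) <= theta).

(* Main.v *)
Require Import Defs.
From HB Require Import structures.
From mathcomp Require Import all_boot all_order all_algebra.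
From mathcomp Require Import all_classical all_reals all_analysis.
From mathcomp Require Import ring lra.

Set Implicit Arguments.
Unset Strict Implicit.
Unset Printing Implicit Defensive.

Import Order.TTheory GRing.Theory Num.Theory.
Import numFieldNormedType.Exports.

Local Open Scope classical_set_scope.
Local Open Scope ring_scope.

(** The error is one-sided, and both sides follow from comparison arguments in
    which the piecewise linear solution u enters only through its nodal values.

    From below there is no error at all: every affine minorant of f is a
    discrete subsolution, so the convex envelope is at most u on the whole mesh
    domain (discrete_solution_ge_affine).

    From above, u is compared with the convex hull of the graph of f, a set of
    pairs (y, v), by doubling the variables: one studies the maximum of
      u (x_i) - v - |x_i - y|^2 / (2 t) + s |x_i|^2
    over the nodes x_i and the pairs (y, v) (discrete_solution_le_hull).  Two
    facts prevent this maximum from exceeding a given e.  First, u <= f at the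
    nodes, so (y, v) would lie well below the graph of f; it would then be the
    midpoint of a segment of the hull whose length is bounded below
    (graph_hull_split): the hull is flat there in some direction, which is the
    degenerate equation satisfied by the convex envelope.  Secondly, a point of
    a strictly convex domain that is the midpoint of a long chord is far from
    the boundary (strictly_convex_midpoint), so the full scale delta is
    available at x_i.  Shifting y along the chord and x_i along the nearest
    direction of the net leaves the penalty almost unchanged: the error in the
    direction costs (delta theta)^2 / t and the interpolation h^2 / t, and both
    are beaten by the gain 2 s delta^2 of the quadratic term when theta and
    h / delta are small.  The boundary layer, where the stencils shrink and
    consistency is lost, is excluded by the second fact, since near the boundary
    f itself is close to its convex envelope.

    Finally u (x) is at most the infimum of v + |x - y|^2 / (2 t) over the hull,
    up to small terms, and this Moreau envelope is at most the convex envelope: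
    the first order condition at a near minimiser exhibits an affine minorant of
    f (le_convex_envelope). *)

(** * Squared Euclidean norm and weighted averages *)

Section SquaredNorm.
Variables (R : realType) (d : nat).
Implicit Types x y z q v : 'rV[R]_d.

Definition sqnorm x : R := \sum_(i < d) x 0 i ^+ 2.
Definition dot x y : R := \sum_(i < d) x 0 i * y 0 i.

Lemma sqnorm_ge0 x : 0 <= sqnorm x.
Proof. by apply: sumr_ge0 => i _; exact: sqr_ge0. Qed.

Lemma sqr_enorm x : enorm x ^+ 2 = sqnorm x.
Proof. by rewrite sqr_sqrtr// sqnorm_ge0. Qed.

Lemma enorm_ge0 x : 0 <= enorm x.
Proof. exact: sqrtr_ge0. Qed.

Lemma sqnormN x : sqnorm (- x) = sqnorm x.
Proof. by apply: eq_bigr => i _; rewrite mxE sqrrN. Qed.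

Lemma sqnormBC x y : sqnorm (x - y) = sqnorm (y - x).
Proof. by rewrite -sqnormN opprB. Qed.

Lemma sqnormZ (t : R) x : sqnorm (t *: x) = t ^+ 2 * sqnorm x.
Proof. by rewrite mulr_sumr; apply: eq_bigr => i _; rewrite mxE exprMn. Qed.

Lemma enormZ (t : R) x : enorm (t *: x) = `|t| * enorm x.
Proof. by rewrite /enorm -!/(sqnorm _) sqnormZ sqrtrM ?sqr_ge0// sqrtr_sqr. Qed.

Lemma sqnormD x y : sqnorm (x + y) = sqnorm x + 2 * dot x y + sqnorm y.
Proof.
rewrite mulr_sumr -!big_split/=; apply: eq_bigr => i _; rewrite !mxE; ring.
Qed.

Lemma sqnorm_parallelogram x y :
  sqnorm (x + y) + sqnorm (x - y) = 2 * sqnorm x + 2 * sqnorm y.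
Proof.
rewrite !mulr_sumr -!big_split/=; apply: eq_bigr => i _; rewrite !mxE; ring.
Qed.

Lemma dotZr (t : R) x y : dot x (t *: y) = t * dot x y.
Proof. by rewrite mulr_sumr; apply: eq_bigr => i _; rewrite mxE; ring. Qed.

Lemma dotxx x : dot x x = sqnorm x.
Proof. by apply: eq_bigr => i _; rewrite expr2. Qed.

Lemma coord_le_norm x (i : 'I_d) : `|x 0 i| <= `|x|.
Proof.
rewrite [leRHS]/Num.norm /= mx_normrE.
by apply: (le_bigmax _ (fun k : 'I_1 * 'I_d => `|x k.1 k.2|) (0, i)).
Qed.

Lemma norm_le_coord x (c : R) : 0 <= c -> (forall i, `|x 0 i| <= c) -> `|x| <= c.
Proof.
move=> c0 xc; rewrite [leLHS]/Num.norm /= mx_normrE.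
by apply: bigmax_le => // -[k i] _ /=; rewrite ord1.
Qed.

Lemma norm_le_sum x : `|x| <= \sum_i `|x 0 i|.
Proof.
apply: norm_le_coord => [|i]; first by apply: sumr_ge0.
by rewrite (bigD1 i)//= lerDl sumr_ge0.
Qed.

Lemma coord_le_enorm x (i : 'I_d) : `|x 0 i| <= enorm x.
Proof.
rewrite -sqrtr_sqr; apply: ler_wsqrtr; rewrite (bigD1 i)//= lerDl.
by apply: sumr_ge0 => j _; exact: sqr_ge0.
Qed.

Lemma norm_le_enorm x : `|x| <= enorm x.
Proof. by apply: norm_le_coord (enorm_ge0 x) _ => i; exact: coord_le_enorm. Qed.

Lemma sqnorm_le_norm x (D : R) : `|x| <= D -> sqnorm x <= d%:R * D ^+ 2.
Proof.
move=> xD; have D0 : 0 <= D by apply: le_trans xD.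
apply: (@le_trans _ _ (\sum_(i < d) D ^+ 2)).
  apply: ler_sum => i _; rewrite -real_normK ?num_real// lerXn2r ?nnegrE//.
  exact: le_trans (coord_le_norm x i) xD.
by rewrite sumr_const card_ord mulr_natl.
Qed.

Lemma enorm_le_norm x (D : R) :
  `|x| <= D -> enorm x <= Num.sqrt (d%:R * D ^+ 2).
Proof. by move=> xD; apply: ler_wsqrtr; exact: sqnorm_le_norm. Qed.

Lemma enorm_eq0 x : enorm x = 0 -> x = 0.
Proof.
move=> x0; apply/normr0_eq0/eqP; rewrite eq_le normr_ge0 andbT -x0.
exact: norm_le_enorm.
Qed.

Lemma sum_coord (I : finType) (a : I -> R) (p : I -> 'rV[R]_d) (k : 'I_d) :
  (\sum_i a i *: p i) 0 k = \sum_i a i * p i 0 k.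
Proof. by rewrite summxE; apply: eq_bigr => i _; rewrite mxE. Qed.

(** Huygens' identity: the cross terms cancel because z is the barycenter of
    the p i.  It measures exactly what interpolating a quadratic penalty at the
    vertices of a simplex costs. *)
Lemma sqnorm_average (I : finType) (a : I -> R) (p : I -> 'rV[R]_d) z q :
  \sum_i a i = 1 -> z = \sum_i a i *: p i ->
  \sum_i a i * sqnorm (p i - q) =
  sqnorm (z - q) + \sum_i a i * sqnorm (p i - z).
Proof.
move=> a1 zE.
have z0 k : \sum_i a i * (p i 0 k - z 0 k) = 0.
  under eq_bigr do rewrite mulrBr.
  by rewrite sumrB -sum_coord -mulr_suml a1 mul1r -zE subrr.
have -> : sqnorm (z - q) = \sum_i a i * sqnorm (z - q) by rewrite -mulr_suml a1 mul1r.
rewrite -big_split/=.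
have -> : \sum_i a i * sqnorm (p i - q) =
  \sum_i (a i * sqnorm (z - q) + a i * sqnorm (p i - z) +
          \sum_(k < d) 2 * (z 0 k - q 0 k) * (a i * (p i 0 k - z 0 k))).
  apply: eq_bigr => i _; rewrite /sqnorm !mulr_sumr -!big_split/=.
  by apply: eq_bigr => k _; rewrite !mxE; ring.
rewrite big_split/= [X in _ + X]exchange_big/= [X in _ + X]big1 ?addr0// => k _.
by rewrite -mulr_sumr z0 mulr0.
Qed.

Lemma sqnorm_jensen (I : finType) (a : I -> R) (p : I -> 'rV[R]_d) z :
  (forall i, 0 <= a i) -> \sum_i a i = 1 -> z = \sum_i a i *: p i ->
  sqnorm z <= \sum_i a i * sqnorm (p i).
Proof.
move=> a0 a1 zE; have := sqnorm_average 0 a1 zE; rewrite subr0.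
under eq_bigr do rewrite subr0.
by move=> ->; rewrite lerDl sumr_ge0// => i _; rewrite mulr_ge0 ?sqnorm_ge0.
Qed.

End SquaredNorm.

(** * Convex hull of the graph of a function *)

Section GraphHull.
Variables (R : realType) (d : nat).
Implicit Types (A : set 'rV[R]_d) (f : 'rV[R]_d -> R).

Definition segment_closed A :=
  forall x y (t : R), A x -> A y -> 0 <= t <= 1 -> A (t *: x + (1 - t) *: y).

(** Induction on the sequence, with the partial sums renormalised so that they
    stay in the set. *)
Lemma segment_closed_sum A (I : eqType) (r : seq I) (a : I -> R)
    (p : I -> 'rV[R]_d) :
  segment_closed A -> (forall i, i \in r -> 0 <= a i) -> (forall i, i \in r -> A (p i)) ->
  \sum_(i <- r) a i = 1 -> A (\sum_(i <- r) a i *: p i).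
Proof.
move=> cA a0 Ap a1.
suff: forall r', {subset r' <= r} -> 0 < \sum_(i <- r') a i ->
    A ((\sum_(i <- r') a i)^-1 *: \sum_(i <- r') a i *: p i).
  by move=> /(_ r (fun x h => h)); rewrite a1 invr1 scale1r; apply.
elim=> [|i r' IH] sub; first by rewrite big_nil ltxx.
have ai0 : 0 <= a i by apply: a0; apply: sub; rewrite inE eqxx.
have Api : A (p i) by apply: Ap; apply: sub; rewrite inE eqxx.
have sub' : {subset r' <= r} by move=> j jr; apply: sub; rewrite inE jr orbT.
have r'0 : 0 <= \sum_(j <- r') a j.
  by rewrite big_seq; apply: sumr_ge0 => j jr; apply: a0; exact: sub'.
rewrite !big_cons => s0.
have [r'E|r'N] := eqVneq (\sum_(j <- r') a j) 0.
  have aj0 j : j \in r' -> a j = 0.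
    move=> jr; apply/eqP; move/eqP: r'E.
    rewrite big_seq psumr_eq0; last by move=> k kr; exact/a0/sub'.
    by move=> /allP/(_ j jr); rewrite jr.
  have -> : \sum_(j <- r') a j *: p j = 0.
    by rewrite big_seq big1// => j jr; rewrite aj0// scale0r.
  move: s0; rewrite r'E !addr0 => s0.
  by rewrite scalerA mulVf ?gt_eqF// scale1r.
have {}r'0 : 0 < \sum_(j <- r') a j by rewrite lt_neqAle eq_sym r'N.
set s := \sum_(j <- r') a j in s0 r'0 *.
have t01 : 0 <= a i / (a i + s) <= 1.
  by rewrite divr_ge0 ?(ltW s0)//= ler_pdivrMr// mul1r lerDl ltW.
have := cA _ _ _ Api (IH sub' r'0) t01.
congr A; rewrite scalerDr !scalerA mulrC; congr (_ + _ *: _).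
by rewrite -/s; field; rewrite !gt_eqF.
Qed.

(** The pair (y, v) lies in the convex hull of the graph of f over A.  The
    lower boundary of this hull is the largest convex minorant of f; working
    with pairs avoids taking an infimum over v for each y. *)
Definition graph_hull A f (y : 'rV[R]_d) (v : R) :=
  exists n (a : 'I_n -> R) (p : 'I_n -> 'rV[R]_d),
    [/\ forall j, 0 <= a j, \sum_j a j = 1, forall j, A (p j),
        y = \sum_j a j *: p j & v = \sum_j a j * f (p j)].

Lemma graph_hull_graph A f z : A z -> graph_hull A f z (f z).
Proof.
move=> Az; exists 1%N, (fun=> 1), (fun=> z).
by split => //; rewrite ?big_ord1 ?scale1r ?mul1r.
Qed.

Lemma graph_hull_segment A f y v z (s : R) :
  graph_hull A f y v -> A z -> 0 <= s <= 1 ->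
  graph_hull A f ((1 - s) *: y + s *: z) ((1 - s) * v + s * f z).
Proof.
move=> [n [a [p [a0 a1 Ap -> ->]]]] Az /andP[s0 s1].
exists n.+1, (fun j => oapp (fun k => (1 - s) * a k) s (unlift ord0 j)),
  (fun j => oapp p z (unlift ord0 j)).
split.
- by move=> j; case: unliftP => [k|] _ //=; rewrite mulr_ge0// subr_ge0.
- rewrite big_ord_recl/= unlift_none/=.
  under eq_bigr do rewrite liftK/=.
  by rewrite -mulr_sumr a1 mulr1 addrC subrK.
- by move=> j; case: unliftP => [k|] _ /=.
- rewrite big_ord_recl/= unlift_none/= addrC scaler_sumr; congr (_ + _).
  by apply: eq_bigr => j _; rewrite liftK/= scalerA.
- rewrite big_ord_recl/= unlift_none/= addrC mulr_sumr; congr (_ + _).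
  by apply: eq_bigr => j _; rewrite liftK/= mulrA.
Qed.

Lemma graph_hull_ge A f y v lo :
  (forall z, A z -> lo <= f z) -> graph_hull A f y v -> lo <= v.
Proof.
move=> lof [n [a [p [a0 a1 Ap _ ->]]]].
by rewrite -[lo]mul1r -a1 mulr_suml ler_sum// => j _; rewrite ler_wpM2l ?lof.
Qed.

Lemma graph_hull_base A f y v :
  segment_closed A -> graph_hull A f y v -> A y.
Proof. by move=> cA [n [a [p [a0 a1 Ap -> _]]]]; exact: segment_closed_sum. Qed.

(** A point of the hull lying below the graph by eta is the midpoint of a
    segment of the hull, of length bounded below.  By the modulus of f, the
    points p j representing (y, v) cannot all be near y: their weighted mean
    distance to y is at least eta / (2 C), hence at least eta / (2 C d) along
    some coordinate i.  Transferring weight between the points on the two sides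
    of the hyperplane of equation z_i = y_i moves y along a direction E, with
    the same transfers in opposite directions giving y + t E and y - t E; the
    new weights are affine in t, so the two ordinates add up to 2 v. *)
Lemma graph_hull_split A f (eta C : R) y v :
  segment_closed A -> 0 < eta -> 0 < C ->
  (forall z, A z -> f y - eta / 2 - C * `|z - y| <= f z) ->
  graph_hull A f y v -> v < f y - eta ->
  exists2 E : 'rV[R]_d, eta / (4 * C * d%:R) <= `|E| &
    forall t : R, 0 <= t <= 1 -> exists vp vm, [/\ vp + vm = 2 * v,
      graph_hull A f (y + t *: E) vp & graph_hull A f (y - t *: E) vm].
Proof.
move=> cA eta0 C0 modf [n [a [p [a0 a1 Ap yE vE]]]] vlt.
pose m i := \sum_j a j * `|p j 0 i - y 0 i|.
have mE : eta / (2 * C) <= \sum_i m i.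
  rewrite ler_pdivrMr ?mulr_gt0// /m exchange_big/=.
  have : \sum_j a j * (f y - eta / 2 - C * \sum_i `|p j 0 i - y 0 i|) <= v.
    rewrite vE; apply: ler_sum => j _; rewrite ler_wpM2l//.
    apply: le_trans (modf _ (Ap j)); rewrite lerD2l lerN2 ler_pM2l//.
    apply: le_trans (norm_le_sum _) _.
    by apply: ler_sum => i _; rewrite !mxE.
  have -> : \sum_j a j * (f y - eta / 2 - C * \sum_i `|p j 0 i - y 0 i|) =
      f y - eta / 2 - C * \sum_j a j * \sum_i `|p j 0 i - y 0 i|.
    rewrite -[X in _ = X - _]mul1r -a1 mulr_suml mulr_sumr -sumrB.
    by apply: eq_bigr => j _; ring.
  under [in X in _ -> _ <= X]eq_bigr do rewrite -mulr_sumr.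
  by move: vlt; lra.
have [i mi] : exists i, eta / (2 * C * d%:R) <= m i.
  apply/not_existsP => mlt.
  have d0 : (0 < d)%N.
    rewrite lt0n; apply/eqP => d0; move: mE; rewrite big1.
      by rewrite leNgt divr_gt0 ?mulr_gt0.
    by case=> k kd; exfalso; move: kd; rewrite d0.
  move: mE; rewrite leNgt => /negP; apply.
  apply: (@lt_le_trans _ _ (\sum_(i < d) eta / (2 * C * d%:R))); last first.
    rewrite sumr_const card_ord -[leLHS]mulr_natr le_eqVlt; apply/orP; left; apply/eqP.
    by field; rewrite !gt_eqF ?ltr0n.
  apply: ltr_sum => [|i _]; last by rewrite ltNge; apply/negP/mlt.
  by apply/hasP; exists (Ordinal d0); rewrite ?mem_index_enum.
pose S := [pred j | y 0 i <= p j 0 i].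
pose L := \sum_(j | S j) a j.
have L0 : 0 <= L by apply: sumr_ge0.
have L1 : L <= 1 by rewrite -a1 [leRHS](bigID S)/= lerDl sumr_ge0.
(* Centred by L, so that the weights a j * (1 + t * e j) still sum to 1. *)
pose e j : R := (S j)%:R - L.
have e1 j : `|e j| <= 1.
  by rewrite /e; case: (S j) => /=; rewrite ler_norml; apply/andP; split; lra.
have ae : \sum_j a j * e j = 0.
  under eq_bigr do rewrite mulrBr.
  rewrite sumrB -mulr_suml a1 mul1r.
  rewrite [X in X - _](_ : _ = L) ?subrr// /L [RHS]big_mkcond/=.
  by apply: eq_bigr => j _; case: (y 0 i <= _); rewrite ?mulr1 ?mulr0.
pose E := \sum_j (a j * e j) *: p j.
(* The deviations along i average to 0, so the points of S account for half of
   the mean absolute deviation. *)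
have Ei : 2 * E 0 i = m i.
  have q0 : \sum_j a j * (p j 0 i - y 0 i) = 0.
    under eq_bigr do rewrite mulrBr.
    by rewrite sumrB -sum_coord -yE -mulr_suml a1 mul1r subrr.
  have -> : E 0 i = \sum_j a j * (S j)%:R * (p j 0 i - y 0 i).
    rewrite /E sum_coord.
    have -> : \sum_j a j * e j * p j 0 i =
        \sum_j a j * e j * (p j 0 i - y 0 i).
      under [RHS]eq_bigr do rewrite mulrBr.
      by rewrite sumrB -mulr_suml ae mul0r subr0.
    transitivity (\sum_j (a j * (S j)%:R * (p j 0 i - y 0 i) - L * (a j * (p j 0 i - y 0 i)))).
      by apply: eq_bigr => j _; rewrite /e; ring.
    by rewrite sumrB -mulr_sumr q0 mulr0 subr0.
  rewrite mulr_sumr -[LHS]subr0 -[X in _ - X]q0 -sumrB; apply: eq_bigr => j _.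
  rewrite /S/=; have [le|lt] := leP (y 0 i) (p j 0 i).
    by rewrite ger0_norm ?subr_ge0//=; ring.
  by rewrite ltr0_norm ?subr_lt0//=; ring.
exists E.
  apply: le_trans (coord_le_norm _ i); apply: le_trans (ler_norm _).
  by move: mi; rewrite -Ei !invfM; lra.
have hull_shift (t : R) : -1 <= t <= 1 ->
    graph_hull A f (y + t *: E) (v + t * \sum_j a j * e j * f (p j)).
  move=> t1; exists n, (fun j => a j * (1 + t * e j)), p; split => //.
  - move=> j; rewrite mulr_ge0//.
    suff : `|t * e j| <= 1 by rewrite ler_norml => /andP[? _]; lra.
    by rewrite normrM mulr_ile1// ler_norml.
  - transitivity (\sum_j (a j + t * (a j * e j))); first by apply: eq_bigr => j _; ring.
    by rewrite big_split/= -mulr_sumr ae a1 mulr0 addr0.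
  - rewrite /E scaler_sumr {1}yE -big_split/=; apply: eq_bigr => j _.
    by rewrite scalerA -scalerDl; congr (_ *: _); ring.
  - rewrite {1}vE mulr_sumr -big_split/=; apply: eq_bigr => j _; ring.
move=> t /andP[t0 t1].
exists (v + t * \sum_j a j * e j * f (p j)), (v + (- t) * \sum_j a j * e j * f (p j)).
split; first by ring.
  by apply: hull_shift; apply/andP; split; lra.
by rewrite -scaleNr; apply: hull_shift; apply/andP; split; lra.
Qed.

End GraphHull.
(** * Affine minorants and the convex envelope *)

Section ConvexEnvelope.
Variables (R : realType) (d : nat) (Omega : set 'rV[R]_d) (f : 'rV[R]_d -> R).

Lemma affine_cst (c : R) : affine (fun _ : 'rV[R]_d => c).
Proof.
exists 0, c => x; rewrite big1 ?add0r// => i _; by rewrite mxE mul0r.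
Qed.

Lemma affine_le_convex_envelope (l : 'rV[R]_d -> R) x :
  closure Omega x -> affine l -> (forall y, closure Omega y -> l y <= f y) ->
  l x <= convex_envelope Omega f x.
Proof.
move=> Ox al lf; apply: sup_upper_bound; last by exists l.
split; first by exists (l x), l.
by exists (f x) => _ [k [_ kf] <-]; exact: kf.
Qed.

Lemma convex_envelope_le (lo M : R) x :
  (forall y, closure Omega y -> lo <= f y) ->
  (forall l, affine l -> (forall y, closure Omega y -> l y <= f y) -> l x <= M) ->
  convex_envelope Omega f x <= M.
Proof.
move=> lof lM; apply: ge_sup.
  by exists lo, (fun=> lo) => //; split => //; exact: affine_cst.
by move=> _ [l [al lf] <-]; exact: lM.
Qed.

(** The Moreau envelope of the hull, the infimum over (y, v) of
    v + |x - y|^2 / (2 t), is at most the convex envelope.  Perturbing a near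
    minimiser (y, v) towards a point (z, f z) of the graph is the first order
    condition saying that the affine function of slope (x - y) / t through
    (y, v) is a minorant of f, up to a small e; its value at x is
    v + |x - y|^2 / t - e.  Near minimality thus plays the part of a
    separation theorem. *)
Lemma le_convex_envelope (D t m : R) x :
  segment_closed (closure Omega) ->
  (forall y, closure Omega y -> `|y| <= D) -> 0 < t -> closure Omega x ->
  (forall y v, graph_hull (closure Omega) f y v ->
    m <= v + sqnorm (x - y) / (2 * t)) ->
  m <= convex_envelope Omega f x.
Proof.
move=> cvO bdO t0 Ox mle.
pose V := [set r | exists y v, graph_hull (closure Omega) f y v /\
                   r = v + sqnorm (x - y) / (2 * t)].
have V_inf : has_inf V.
  split; last by exists m => _ [y [v [yv ->]]]; exact: mle.
  by eexists; exists x, (f x); split => //; exact: graph_hull_graph.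
have mI : m <= inf V.
  by apply: lb_le_inf V_inf.1 _ => _ [y [v [yv ->]]]; exact: mle.
apply: le_trans mI _; apply/ler_addgt0Pr => e e0.
pose B : R := d%:R * (D + D) ^+ 2 + 1.
have B0 : 0 < B by rewrite ltr_wpDl// mulr_ge0// sqr_ge0.
have sqB y z : closure Omega y -> closure Omega z -> sqnorm (y - z) <= B.
  move=> Oy Oz; apply: (@le_trans _ _ (d%:R * (D + D) ^+ 2)); last first.
    by rewrite lerDl.
  apply: sqnorm_le_norm; apply: le_trans (ler_normB _ _) _.
  by rewrite lerD ?bdO.
(* Step towards z: the second order term s^2 B / (2 t) is at most s e / 2, and
   the defect s e / 2 of minimality takes the other half of s e. *)
pose s : R := Num.min 1 (e * t / B).
have s0 : 0 < s by rewrite lt_min ltr01 divr_gt0 ?mulr_gt0.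
have s1 : s <= 1 by rewrite ge_min lexx.
have sB : s * B <= e * t by rewrite -ler_pdivlMr// ge_min lexx orbT.
have e2 : 0 < e / 2 by rewrite divr_gt0.
have [_ [y [v [yv ->]]] near_min] := inf_adherent (mulr_gt0 s0 e2) V_inf.
have Oy := graph_hull_base cvO yv.
pose l z := v + dot (x - y) (z - y) / t - e.
have al : affine l.
  exists (t^-1 *: (x - y)), (v - e - dot (x - y) y / t) => z; rewrite /l.
  have -> : dot (x - y) (z - y) = \sum_i (x - y) 0 i * z 0 i - dot (x - y) y.
    by rewrite -sumrB; apply: eq_bigr => i _; rewrite !mxE; ring.
  have -> : \sum_i (t^-1 *: (x - y)) 0 i * z 0 i = t^-1 * \sum_i (x - y) 0 i * z 0 i.
    by rewrite mulr_sumr; apply: eq_bigr => i _; rewrite !mxE; ring.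
  by ring.
have lf z : closure Omega z -> l z <= f z.
  move=> Oz.
  have s01 : 0 <= s <= 1 by rewrite (ltW s0) s1.
  have : inf V <= (1 - s) * v + s * f z +
      sqnorm (x - ((1 - s) *: y + s *: z)) / (2 * t).
    apply: (ge_inf V_inf.2).
    by eexists; eexists; split; [exact: (graph_hull_segment yv Oz s01)|].
  have -> : x - ((1 - s) *: y + s *: z) = (x - y) + (- s) *: (z - y).
    by apply/rowP => i; rewrite !mxE; ring.
  rewrite sqnormD dotZr sqnormZ => inf_le.
  have sq := sqB _ _ Oz Oy.
  have : s * l z <= s * f z; last by rewrite ler_pM2l.
  have h : s ^+ 2 * sqnorm (z - y) / (2 * t) <= s * (e / 2).
    rewrite ler_pdivrMr ?mulr_gt0//.
    apply: (@le_trans _ _ (s * (s * B))); first by rewrite expr2 -mulrA !ler_pM2l.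
    apply: (@le_trans _ _ (s * (e * t))); first by rewrite ler_pM2l.
    by rewrite le_eqVlt; apply/orP; left; apply/eqP; field.
  move: near_min inf_le h; rewrite /l sqrrN.
  move: (dot _ _) (sqnorm (x - y)) (sqnorm (z - y)) => P Q W.
  have -> : (Q + 2 * (- s * P) + s ^+ 2 * W) / (2 * t) =
    Q / (2 * t) - s * (P / t) + s ^+ 2 * W / (2 * t) by field; rewrite gt_eqF.
  move: (Q / _) (_ * W / _) (P / t) => Q' W' P'.
  by lra.
have := affine_le_convex_envelope Ox al lf; rewrite /l dotxx => le_ce.
have Iv : inf V <= v + sqnorm (x - y) / (2 * t).
  by apply: (ge_inf V_inf.2); exists y, v.
have Q0 : 0 <= sqnorm (x - y) / (2 * t).
  by rewrite divr_ge0 ?sqnorm_ge0// mulr_ge0// ltW.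
move: le_ce Iv Q0; have -> : sqnorm (x - y) / t = 2 * (sqnorm (x - y) / (2 * t)).
  by field; rewrite gt_eqF.
by lra.
Qed.

End ConvexEnvelope.

(** * Uniform estimates from compactness *)

Section Compactness.
Variables (R : realType) (d : nat).
Implicit Types (K Omega : set 'rV[R]_d).

Lemma compact_uniform_modulus K (f : 'rV[R]_d -> R) (e : R) :
  compact K -> {within K, continuous f} -> 0 < e ->
  exists2 r : R, 0 < r &
    forall x y, K x -> K y -> `|x - y| <= r -> `|f x - f y| <= e.
Proof.
move=> cK cf e0.
pose P (r : R) x := K x -> forall y, K y -> `|x - y| <= r -> `|f x - f y| <= e.
have cover : forall x, K x -> \forall x' \near x & r \near 0^'+, P r x'.
  move=> x Kx.
  have : \forall z \near x, K z -> `|f x - f z| < e / 2.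
    have /subspace_continuousP/(_ x Kx)/cvgrPdist_lt/(_ (e / 2)) := cf.
    by rewrite divr_gt0// => /(_ isT).
  move=> /nbhs_ballP[q /= q0 Bq].
  exists (ball x (q / 2), [set r | r < q / 2]) => /=.
    split; first by apply: nbhsx_ballx; rewrite divr_gt0.
    by apply: nbhs_right_lt; rewrite divr_gt0.
  move=> [z r] [/= xz rq] Kz y Ky zy.
  have xzn : `|x - z| < q / 2 by move: xz; rewrite -ball_normE.
  have fz : `|f x - f z| < e / 2.
    by apply: Bq => //; rewrite -ball_normE /= (lt_le_trans xzn)//; lra.
  have fy : `|f x - f y| < e / 2.
    apply: Bq => //; rewrite -ball_normE /= -(subrK z x) -addrA.
    rewrite (le_lt_trans (ler_normD _ _))//; lra.
  rewrite -(subrK (f x) (f z)) -addrA (le_trans (ler_normD _ _))//.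
  by rewrite (distrC (f z)); lra.
have [r0 /= [r00 H]] : \forall r \near 0^'+, K `<=` P r.
  by have /compact_near_coveringP := cK; apply.
exists (r0 / 2); first by rewrite divr_gt0.
move=> x y Kx Ky xy; apply: (H (r0 / 2)) xy => //=; last by rewrite divr_gt0.
rewrite sub0r normrN gtr0_norm ?divr_gt0//; lra.
Qed.

(** Beyond the distance r of uniform continuity the bound on f is absorbed by
    the linear term.  This form of the modulus can be averaged over convex
    combinations and compared with a quadratic penalty. *)
Lemma compact_linear_modulus K (f : 'rV[R]_d -> R) (F e : R) :
  compact K -> {within K, continuous f} -> 0 < e ->
  (forall x, K x -> `|f x| <= F) ->
  exists2 C : R, 0 < C &
    forall x y, K x -> K y -> `|f x - f y| <= e + C * `|x - y|.
Proof.
move=> cK cf e0 fF; have [r r0 H] := compact_uniform_modulus cK cf e0.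
have [K0|/set0P[x0 Kx0]] := eqVneq K set0.
  by exists 1 => // x y; rewrite K0.
have F0 : 0 <= F by apply: le_trans (fF _ Kx0).
exists (2 * F / r + 1); first by rewrite ltr_wpDl// divr_ge0 ?mulr_ge0// ltW.
move=> x y Kx Ky; have [xy|xy] := leP `|x - y| r.
  apply: le_trans (H _ _ Kx Ky xy) _; rewrite lerDl mulr_ge0// addr_ge0//.
  by rewrite divr_ge0 ?mulr_ge0// ltW.
apply: (@le_trans _ _ (F + F)).
  by apply: le_trans (ler_normB _ _) _; rewrite lerD ?fF.
have : 2 * F / r * r <= (2 * F / r + 1) * `|x - y|.
  by rewrite ler_pM ?divr_ge0 ?mulr_ge0 ?lerDl// ltW.
rewrite divfK ?gt_eqF//; lra.
Qed.

(** Midpoints of chords of length at least 2 c form a compact set, contained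
    in Omega by strict convexity, hence at a positive distance from the
    complement.  The chord is given by its midpoint y and half-vector E. *)
Lemma strictly_convex_midpoint Omega (c : R) :
  open Omega -> compact (closure Omega) -> strictly_convex Omega -> 0 < c ->
  exists2 r : R, 0 < r &
    forall y E b, closure Omega (y + E) -> closure Omega (y - E) ->
      c <= `|E| -> ~ Omega b -> r <= `|y - b|.
Proof.
move=> oO cO scO c0.
pose K := closure Omega `*` closure Omega.
pose P (r : R) (w : 'rV[R]_d * 'rV[R]_d) := K w -> 2 * c <= `|w.1 - w.2| ->
  forall b, ~ Omega b -> r <= `|2^-1 *: (w.1 + w.2) - b|.
have cover : forall w, K w -> \forall w' \near w & r \near 0^'+, P r w'.
  move=> [p q] [/= Op Oq].
  (* Near a degenerate pair (p, p) every chord is shorter than 2 c. *)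
  have [pq|npq] := eqVneq p q.
    exists (ball p c `*` ball q c, setT) => /=.
      split; last exact: filterT.
      by exists (ball p c, ball q c) => //=; split; apply: nbhsx_ballx.
    move=> [[p' q'] r] /= [[+ +] _] _ /= le2c; rewrite -ball_normE /= -pq => pp' pq'.
    exfalso; move: le2c; rewrite leNgt => /negP; apply.
    rewrite -(subrK p p') -addrA (le_lt_trans (ler_normD _ _))//.
    by rewrite (distrC p'); lra.
  have Om : Omega (2^-1 *: (p + q)).
    have h : 0 < (2^-1 : R) < 1 by apply/andP; split; lra.
    have := scO _ _ Op Oq npq _ h.
    by rewrite (_ : 1 - 2^-1 = 2^-1 :> R) ?scalerDr//; lra.
  have /nbhs_ballP[e /= e0 Be] : nbhs (2^-1 *: (p + q)) Omega by exact: open_nbhs_nbhs.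
  exists (ball p (e / 2) `*` ball q (e / 2), [set r | r < e / 2]) => /=.
    split; last by apply: nbhs_right_lt; rewrite divr_gt0.
    exists (ball p (e / 2), ball q (e / 2)) => //=.
    by split; apply: nbhsx_ballx; rewrite divr_gt0.
  move=> [[p' q'] r] /= [[+ +] re] _ _ b nOb.
  rewrite -ball_normE /= => pp' qq'; rewrite leNgt; apply/negP => br.
  apply: nOb; apply: Be; rewrite -ball_normE /=.
  have -> : 2^-1 *: (p + q) - b =
      2^-1 *: ((p - p') + (q - q')) + (2^-1 *: (p' + q') - b).
    by apply/rowP => i; rewrite !mxE; ring.
  apply: le_lt_trans (ler_normD _ _) _.
  have h : `|2^-1 *: ((p - p') + (q - q'))| <= 2^-1 * (`|p - p'| + `|q - q'|).
    by rewrite normrZ gtr0_norm ?invr_gt0// ler_pM2l ?invr_gt0// ler_normD.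
  by move: h br pp' qq' re; lra.
have [r0 /= [r00 H]] : \forall r \near 0^'+, K `<=` P r.
  have /compact_near_coveringP : compact K by exact: compact_setX.
  by apply.
exists (r0 / 2); first by rewrite divr_gt0.
move=> y E b Op Oq cE nOb.
have := H (r0 / 2) _ _ (y + E, y - E) (conj Op Oq) (conj Op Oq) _ b nOb; rewrite /=.
have -> : 2^-1 *: (y + E + (y - E)) = y.
  by apply/rowP => i; rewrite !mxE; field.
apply.
- rewrite sub0r normrN gtr0_norm ?divr_gt0//; lra.
- by rewrite divr_gt0.
- have -> : y + E - (y - E) = 2 *: E by apply/rowP => i; rewrite !mxE; ring.
  by rewrite normrZ ger0_norm// ler_pM2l.
Qed.

End Compactness.
(** * Simplices *)

Section Affine.
Variables (R : realType) (d : nat).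

Lemma affine_average (l : 'rV[R]_d -> R) (I : finType) (a : I -> R)
    (p : I -> 'rV[R]_d) :
  affine l -> \sum_i a i = 1 -> l (\sum_i a i *: p i) = \sum_i a i * l (p i).
Proof.
move=> [q [c lE]] a1; rewrite lE.
under [RHS]eq_bigr do rewrite lE mulrDr.
rewrite big_split/= -mulr_suml a1 mul1r; congr (_ + c).
under [RHS]eq_bigr do rewrite mulr_sumr.
rewrite exchange_big/=; apply: eq_bigr => k _.
by rewrite sum_coord mulr_sumr; apply: eq_bigr => i _; ring.
Qed.

Lemma affine_continuous (l : 'rV[R]_d -> R) : affine l -> continuous l.
Proof.
move=> [q [c lE]].
have -> : l = (fun x => (\sum_i q 0 i * x 0 i) + c) by apply/funext.
move=> x; apply: continuousD; last exact: cst_continuous.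
suff : continuous (fun y : 'rV[R]_d => \sum_i q 0 i * y 0 i) by apply.
apply: continuous_big => [y|i _ y]; first exact: add_continuous.
by apply: continuousM; [exact: cst_continuous|exact: coord_continuous].
Qed.

End Affine.

Section Simplex.
Variables (R : realType) (d n : nat) (p : 'I_n -> 'rV[R]_d) (s : {set 'I_n}).

(** Affine independence says that the matrix with rows (1, p i) has a trivial
    left kernel; with d + 1 rows it is invertible, and the coordinates of x are
    the entries of (1, x) times its inverse.  Being affine in x, they present
    the simplex as a finite intersection of closed half-spaces. *)
Lemma barycentric_coordinates :
  #|s| = d.+1 -> affinely_independent p s ->
  exists b : 'I_n -> 'rV[R]_d -> R,
    [/\ forall i, affine (b i), forall x, \sum_(i in s) b i x = 1 &
        forall x, \sum_(i in s) b i x *: p i = x].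
Proof.
move=> cs indep.
have [i0 i0s] : exists i, i \in s by apply/card_gt0P; rewrite cs.
pose A : 'M[R]_(#|s|, 1 + d) :=
  \matrix_(k < #|s|) row_mx (1%:M : 'M[R]_1) (p (enum_val k)).
have A0 k j : A k (lshift d j) = 1 by rewrite mxE row_mxEl !ord1 mxE eqxx.
have Ap k i : A k (rshift 1 i) = p (enum_val k) 0 i by rewrite mxE row_mxEr.
have Afree : row_free A.
  rewrite -kermx_eq0; apply/rowV0P => v /sub_kermxP vA0.
  pose a i := v 0 (enum_rank_in i0s i).
  have a0 : forall i, i \in s -> a i = 0.
    apply: indep.
      rewrite big_enum_val/=.
      have := congr1 (fun M : 'M[R]_(1, 1 + d) => M ord0 (lshift d 0)) vA0.
      rewrite !mxE => vA; rewrite -[RHS]vA; apply: eq_bigr => k _.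
      by rewrite A0 mulr1 /a enum_valK_in.
    rewrite big_enum_val/=; apply/rowP => i.
    have := congr1 (fun M : 'M[R]_(1, 1 + d) => M ord0 (rshift 1 i)) vA0.
    rewrite [X in X = _ -> _]mxE [X in _ = X -> _]mxE => vA.
    rewrite [RHS]mxE -[RHS]vA sum_coord; apply: eq_bigr => k _.
    by rewrite Ap /a enum_valK_in.
  apply/rowP => k; rewrite mxE -(enum_valK_in i0s k).
  by apply: a0; exact: enum_valP.
have /row_fullP[B BA] : row_full A.
  by move: Afree; rewrite /row_free /row_full => /eqP ->; rewrite cs.
pose w x : 'rV_#|s| := row_mx (1%:M : 'M[R]_1) x *m B.
have wA x : w x *m A = row_mx 1%:M x by rewrite /w -mulmxA BA mulmx1.
exists (fun i x => w x 0 (enum_rank_in i0s i)); split.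
- move=> i; set k := enum_rank_in _ _.
  exists (\row_j B (rshift 1 j) k), (B (lshift d 0) k) => x.
  rewrite /w mxE big_split_ord/= big_ord1 row_mxEl mxE eqxx mul1r addrC.
  congr (_ + _); apply: eq_bigr => j _; by rewrite row_mxEr mxE mulrC.
- move=> x; rewrite big_enum_val/=.
  have := congr1 (fun M : 'M[R]_(1, 1 + d) => M ord0 (lshift d 0)) (wA x).
  rewrite row_mxEl [X in X = _ -> _]mxE [X in _ = X -> _]mxE eqxx => wA1; rewrite -[RHS]wA1.
  by apply: eq_bigr => k _; rewrite A0 mulr1 enum_valK_in.
- move=> x; rewrite big_enum_val/=; apply/rowP => i.
  have := congr1 (fun M : 'M[R]_(1, 1 + d) => M ord0 (rshift 1 i)) (wA x).
  rewrite row_mxEr [X in X = _ -> _]mxE => wAx; rewrite -[RHS]wAx sum_coord.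
  by apply: eq_bigr => k _; rewrite Ap enum_valK_in.
Qed.

Lemma hull_barycentric (b : 'I_n -> 'rV[R]_d -> R) :
  affinely_independent p s ->
  (forall x, \sum_(i in s) b i x = 1) ->
  (forall x, \sum_(i in s) b i x *: p i = x) ->
  hull p s = [set x | forall i, i \in s -> 0 <= b i x].
Proof.
move=> indep b1 bx; apply/seteqP; split=> [x [a [a0 a1 xE]] i si | x b0] /=.
  have : a i - b i x = 0.
    apply: (indep (fun i => a i - b i x)) si.
      by rewrite sumrB a1 b1 subrr.
    by under eq_bigr do rewrite scalerBl; rewrite sumrB -xE bx subrr.
  by move/eqP; rewrite subr_eq0 => /eqP <-.
exists (fun i => if i \in s then b i x else 0); split.
- by move=> i; case: ifPn => // /b0.
- by rewrite -[RHS](b1 x); apply: eq_bigr => i ->.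
- by rewrite -[LHS](bx x); apply: eq_bigr => i ->.
Qed.

Lemma hull_closed : #|s| = d.+1 -> affinely_independent p s -> closed (hull p s).
Proof.
move=> cs indep; have [b [ba b1 bx]] := barycentric_coordinates cs indep.
rewrite (hull_barycentric indep b1 bx).
rewrite (_ : [set x | _] = \bigcap_(i in [set i | i \in s]) (b i @^-1` [set r | 0 <= r])).
  apply: closed_bigI => i _; move: (affine_continuous (ba i)).
  by move=> /continuous_closedP; apply; exact: closed_ge.
by apply/seteqP; split => x /=.
Qed.

(** Points moved slightly towards the barycenter have positive barycentric
    coordinates, and these persist in a neighbourhood. *)
Lemma hull_sub_closure_interior :
  #|s| = d.+1 -> affinely_independent p s -> hull p s `<=` closure (hull p s)°.
Proof.
move=> cs indep; have [b [ba b1 bx]] := barycentric_coordinates cs indep.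
have hE := hull_barycentric indep b1 bx.
have int_pos x : (forall i, i \in s -> 0 < b i x) -> (hull p s)° x.
  move=> bpos; rewrite hE /interior.
  have : \forall y \near x, forall i, i \in s -> 0 < b i y.
    apply: (@filter_forall _ _ (fun i y => i \in s -> 0 < b i y) (nbhs x)) => i.
    have [si|nsi] := boolP (i \in s); last by apply: filterE => y.
    have pos_nbhs : nbhs (b i x) [set r | 0 < r] by exact/lt_nbhsr/bpos.
    have : \forall y \near x, 0 < b i y := affine_continuous (ba i) pos_nbhs.
    by apply: filterS => y + _.
  by apply: filterS => y bp i /bp/ltW.
pose c := \sum_(i in s) d.+1%:R^-1 *: p i.
have bE a x : \sum_(i in s) a i = 1 -> x = \sum_(i in s) a i *: p i ->
    forall i, i \in s -> b i x = a i.
  move=> a1 xE i si; apply/eqP; rewrite -subr_eq0; apply/eqP.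
  apply: (indep (fun i => b i x - a i)) si.
    by rewrite sumrB a1 b1 subrr.
  by under eq_bigr do rewrite scalerBl; rewrite sumrB -xE bx subrr.
move=> z [a [a0 a1 zE]] B /nbhs_ballP[e /= e0 eB].
pose t := e / (e + `|c - z|).
have den : 0 < e + `|c - z| by rewrite ltr_pwDl.
have t0 : 0 < t by rewrite divr_gt0.
have t1 : t <= 1 by rewrite ler_pdivrMr// mul1r lerDl.
exists (z + t *: (c - z)); split.
  apply: int_pos => i si.
  rewrite (bE (fun i => (1 - t) * a i + t * d.+1%:R^-1)) => //.
  - by rewrite ltr_wpDl// ?mulr_ge0 ?mulr_gt0// ?subr_ge0// invr_gt0.
  - rewrite big_split/= -!mulr_sumr a1 sumr_const cs -[X in t * X]mulr_natl.
    by rewrite mulfV ?pnatr_eq0//; ring.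
  - have -> : z + t *: (c - z) = (1 - t) *: z + t *: c.
      by apply/rowP => k; rewrite !mxE; ring.
    rewrite {1}zE /c !scaler_sumr -big_split/=; apply: eq_bigr => k _.
    by rewrite !scalerA -scalerDl.
apply: eB; rewrite -ball_normE /= opprD addNKr normrN normrZ gtr0_norm//.
by rewrite /t mulrAC ltr_pdivrMr// ltr_pM2l// ltrDr.
Qed.

Lemma norm_hull_le x : hull p s x -> `|x| <= \sum_(i in s) `|p i|.
Proof.
move=> [a [a0 a1 ->]]; apply: le_trans (ler_norm_sum _ _ _) _.
apply: ler_sum => i si; rewrite normrZ ger0_norm// ler_piMl//.
by rewrite -a1 (bigD1 i)//= lerDl sumr_ge0.
Qed.

Lemma enorm_le_diam_hull x y :
  hull p s x -> hull p s y -> enorm (x - y) <= diam (hull p s).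
Proof.
move=> hx hy; apply: sup_upper_bound; last by exists (x, y).
split; first by exists (enorm (x - y)), (x, y).
pose D := \sum_(i in s) `|p i|.
exists (Num.sqrt (d%:R * (D + D) ^+ 2)) => _ [[u v] [/= hu hv] <-].
apply: enorm_le_norm; apply: le_trans (ler_normB _ _) _.
by rewrite lerD ?norm_hull_le.
Qed.

Lemma vertex_hull i : i \in s -> hull p s (p i).
Proof.
move=> si; exists (fun j => (j == i)%:R); split.
- by move=> j; exact: ler0n.
- rewrite (bigD1 i)//= eqxx big1 ?addr0// => j /andP[_ /negbTE->].
  by [].
- rewrite (bigD1 i)//= eqxx scale1r big1 ?addr0// => j /andP[_ /negbTE->].
  by rewrite scale0r.
Qed.

End Simplex.

(** * Geometry of a mesh *)

Section MeshGeometry.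
Variables (R : realType) (d : nat) (T : mesh R d).

Lemma simplex_sub_closure (s : {set 'I_(mesh_card T)}) :
  s \in elements T -> simplex s `<=` closure (mesh_domain T).
Proof.
move=> sT; apply: subset_trans (hull_sub_closure_interior (card_element sT)
  (element_affinely_independent sT)) _.
by apply: closureS; apply: interiorS => x sx; exists s.
Qed.

Lemma closure_mesh_domain_simplex x : closure (mesh_domain T) x ->
  exists2 s, s \in elements T & simplex s x.
Proof.
pose U := \bigcup_(s in [set s | s \in elements T]) simplex s.
have cU : closed U.
  apply: closed_bigcup; first exact: finite_finpred.
  by move=> s sT; apply: hull_closed;
    [exact: card_element|exact: element_affinely_independent].
move=> cx; have [s sT sx] : U x.
  by rewrite -/U (closure_id U).1//; apply: closureS cx; exact: interior_subset.
by exists s.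
Qed.

Lemma node_closure (i : 'I_(mesh_card T)) : closure (mesh_domain T) (node i).
Proof.
have [s sT si] := node_in_element i.
by apply: (simplex_sub_closure sT); exact: vertex_hull.
Qed.

Lemma mesh_domain_nonempty : mesh_domain T !=set0.
Proof.
have /finset.set0Pn[s sT] := elements_neq0 T.
have [i si] : exists i, i \in s by apply/card_gt0P; rewrite card_element.
by have /(_ setT filterT)[x [Tx _]] := @node_closure i; exists x.
Qed.

Lemma enorm_le_mesh_size (s : {set 'I_(mesh_card T)}) x y :
  s \in elements T -> simplex s x -> simplex s y -> enorm (x - y) <= mesh_size T.
Proof.
move=> sT sx sy; apply: le_trans (enorm_le_diam_hull sx sy) _.
exact: (le_bigmax_cond _ (fun s : {set 'I_(mesh_card T)} => diam (simplex s))).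
Qed.

Lemma mesh_size_gt0 : (0 < d)%N -> 0 < mesh_size T.
Proof.
move=> d0; have /finset.set0Pn[s sT] := elements_neq0 T.
have : (1 < #|s|)%N by rewrite card_element.
move=> /card_gt1P[i [j [si sj ij]]].
apply: lt_le_trans (enorm_le_mesh_size sT (vertex_hull _ si) (vertex_hull _ sj)).
rewrite lt_neqAle enorm_ge0 andbT eq_sym; apply: contraNneq ij => /enorm_eq0/eqP.
by rewrite subr_eq0 => /eqP/node_inj->.
Qed.

(** All that the comparison arguments use of the finite element space: a
    function of this space is, at each point, the average of its nodal values
    with the interpolation weights, and these are concentrated on nodes within
    the mesh size. *)
Lemma piecewise_linear_average (w : 'rV[R]_d -> R) x :
  piecewise_linear T w -> closure (mesh_domain T) x ->
  exists a : 'I_(mesh_card T) -> R,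
    [/\ forall i, 0 <= a i, \sum_i a i = 1, x = \sum_i a i *: node i,
        w x = \sum_i a i * w (node i) &
        \sum_i a i * sqnorm (node i - x) <= mesh_size T ^+ 2].
Proof.
move=> [_ wlin] /closure_mesh_domain_simplex[s sT sx].
have [l al wl] := wlin _ sT; have [a [a0 a1 xE]] := sx.
pose a' i := if i \in s then a i else 0.
have sumE (V : zmodType) (F : 'I_(mesh_card T) -> V) :
    (forall i, i \notin s -> F i = 0) -> \sum_i F i = \sum_(i in s) F i.
  move=> F0; rewrite [RHS]big_mkcond/=; apply: eq_bigr => i _.
  by case: ifPn => // /F0.
have a'1 : \sum_i a' i = 1.
  rewrite sumE; last by move=> i /negbTE si; rewrite /a' si.
  by rewrite -[RHS]a1; apply: eq_bigr => i si; rewrite /a' si.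
have xE' : x = \sum_i a' i *: node i.
  rewrite sumE; last by move=> i /negbTE si; rewrite /a' si scale0r.
  by rewrite {1}xE; apply: eq_bigr => i si; rewrite /a' si.
exists a'; split => //.
- by move=> i; rewrite /a'; case: ifP.
- rewrite wl// {1}xE' affine_average//; apply: eq_bigr => i _.
  rewrite /a'; case: ifPn => [si|]; last by rewrite !mul0r.
  by rewrite wl//; exact: vertex_hull.
- rewrite -[leRHS]mul1r -a'1 mulr_suml; apply: ler_sum => i _.
  rewrite /a'; case: ifPn => [si|]; last by rewrite !mul0r.
  rewrite ler_wpM2l// -sqr_enorm lerXn2r ?nnegrE ?enorm_ge0//.
    by apply: le_trans (enorm_ge0 (x - x)) (enorm_le_mesh_size sT sx sx).
  by apply: enorm_le_mesh_size sx => //; exact: vertex_hull.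
Qed.

End MeshGeometry.
(** * Convex domains and their boundary *)

Section ConvexSets.
Variables (R : realType) (d : nat).
Implicit Types (A C : set 'rV[R]_d).

Lemma convex_set_segment_closed A : convex_set A -> segment_closed A.
Proof.
move=> cA x y t Ax Ay /andP[t0 t1].
by have := cA x y (Itv01 t0 t1); rewrite !inE; apply.
Qed.

Lemma strictly_convex_segment_closed A :
  strictly_convex A -> segment_closed (closure A).
Proof.
move=> sA x y t cx cy /andP[t0 t1].
have [->|xy] := eqVneq x y.
  by rewrite -scalerDl addrC subrK scale1r.
move: t0 t1; rewrite !le_eqVlt => /predU1P[<-|t0].
  by rewrite scale0r subr0 scale1r add0r.
move=> /predU1P[->|t1]; first by rewrite subrr scale0r scale1r addr0.
by apply: subset_closure; apply: sA => //; rewrite t0.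
Qed.

Lemma closure_norm_le A : bounded_set A ->
  exists2 D : R, 0 < D & forall x, closure A x -> `|x| <= D.
Proof.
move=> [M [Mr MA]]; exists (Num.max M 0 + 1).
  by rewrite ltr_wpDl// le_max lexx orbT.
have cN : closed [set x : 'rV[R]_d | `|x| <= Num.max M 0 + 1].
  by apply: ((continuous_closedP _).1 _ _ (@closed_le R _)); exact: norm_continuous.
suff AD : A `<=` [set x : 'rV[R]_d | `|x| <= Num.max M 0 + 1].
  by move=> x /(closureS AD); rewrite -(closure_id _).1.
move=> y Ay /=.
by apply: MA => //; rewrite (@le_lt_trans _ _ (Num.max M 0)) ?le_max ?lexx// ltrDl.
Qed.

(** The last parameter for which the segment is still in C gives a boundary
    point. *)
Lemma segment_meets_boundary C x z : open C -> C x -> ~ C z ->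
  exists2 t : R, 0 <= t <= 1 & boundary C (x + t *: (z - x)).
Proof.
move=> oC Cx nCz.
pose S := [set t : R | 0 <= t <= 1 /\ C (x + t *: (z - x))].
have S0 : S 0 by split; [rewrite lexx ler01|rewrite scale0r addr0].
have supS : has_sup S by split; [exists 0|exists 1 => t [/andP[]]].
have t0 : 0 <= sup S by apply: sup_upper_bound.
have t1 : sup S <= 1 by apply: ge_sup => [|t [/andP[]]//]; exists 0.
exists (sup S); first by rewrite t0.
have lip (t t' : R) : `|(x + t *: (z - x)) - (x + t' *: (z - x))| <= `|t - t'| * `|z - x|.
  by rewrite opprD addrACA subrr add0r -scalerBl normrZ.
split.
  move=> B /nbhs_ballP[e /= e0 eB].
  have den : 0 < `|z - x| + 1 by rewrite ltr_wpDl.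
  have [t [t01 Ct] lt_t] := sup_adherent (divr_gt0 e0 den) supS.
  exists (x + t *: (z - x)); split => //; apply: eB; rewrite -ball_normE /=.
  apply: le_lt_trans (lip _ _) _.
  have tS : t <= sup S by apply: sup_upper_bound.
  rewrite ger0_norm ?subr_ge0//.
  apply: (@le_lt_trans _ _ ((sup S - t) * (`|z - x| + 1))).
    by rewrite ler_wpM2l ?subr_ge0// lerDl.
  by rewrite -ltr_pdivlMr//; lra.
rewrite -/(interior _) (interior_id C).1// => Cb.
have ltS1 : sup S < 1.
  rewrite lt_neqAle t1 andbT; apply/eqP => S1; apply: nCz.
  by move: Cb; rewrite S1 scale1r addrCA subrr addr0.
have /nbhs_ballP[e /= e0 eB] : nbhs (x + sup S *: (z - x)) C by exact: open_nbhs_nbhs.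
have den : 0 < `|z - x| + 1 by rewrite ltr_wpDl.
pose q := Num.min (1 - sup S) (e / (`|z - x| + 1) / 2).
have q0 : 0 < q by rewrite lt_min subr_gt0 ltS1 !divr_gt0.
have : S (sup S + q).
  split.
    rewrite addr_ge0 ?(ltW q0)//= -lerBrDl; by rewrite /q ge_min lexx.
  apply: eB; rewrite -ball_normE /=; apply: le_lt_trans (lip _ _) _.
  have -> : sup S - (sup S + q) = - q by ring.
  rewrite normrN gtr0_norm//.
  apply: (@lt_le_trans _ _ (q * 2 * (`|z - x| + 1))).
    apply: (@lt_le_trans _ _ (q * (`|z - x| + 1))).
      by rewrite ltr_pM2l// ltrDl.
    by rewrite ler_wpM2r// ?(ltW den)//; lra.
  by rewrite -ler_pdivlMr// -ler_pdivlMr// /q ge_min lexx orbT.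
by move=> /(sup_upper_bound supS); rewrite gerDl leNgt q0.
Qed.

Lemma boundary_nonempty C : (0 < d)%N -> open C -> bounded_set C -> C !=set0 ->
  boundary C !=set0.
Proof.
move=> d0 oC bC [x Cx]; have [D D0 CD] := closure_norm_le bC.
have nC : ~ C (const_mx (D + 1)).
  move=> /subset_closure/CD; apply/negP; rewrite -ltNge.
  apply: lt_le_trans (coord_le_norm _ (Ordinal d0)).
  by rewrite mxE gtr0_norm ?addr_gt0// ltrDl.
by have [t _ bt] := segment_meets_boundary oC Cx nC; eexists; exact: bt.
Qed.

Lemma open_boundaryN C x : open C -> boundary C x -> ~ C x.
Proof. by move=> oC [_]; rewrite (interior_id C).1. Qed.

Lemma le_euclid_dist A x r : A !=set0 ->
  (forall y, A y -> r <= enorm (x - y)) -> r <= euclid_dist x A.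
Proof.
move=> [y Ay] rle; apply: lb_le_inf; first by exists (enorm (x - y)), y.
by move=> _ [z Az <-]; exact: rle.
Qed.

Lemma euclid_dist_le A x y : A y -> euclid_dist x A <= enorm (x - y).
Proof.
move=> Ay; apply: ge_inf; last by exists y.
by exists 0 => _ [z _ <-]; exact: enorm_ge0.
Qed.

(** Otherwise the segment from x to x + w would meet the boundary strictly
    before its end point. *)
Lemma closure_of_lt_dist C x w : open C -> C x ->
  enorm w <= euclid_dist x (boundary C) -> closure C (x + w).
Proof.
move=> oC Cx wle; apply: contrapT => ncl.
have [t /andP[t0 t1] bt] := segment_meets_boundary oC Cx (fun h => ncl (subset_closure h)).
have {}t1 : t < 1.
  rewrite lt_neqAle t1 andbT; apply/eqP => tE; apply: ncl.
  by case: bt => + _; rewrite tE scale1r addrCA subrr addr0.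
have := euclid_dist_le x bt; rewrite leNgt => /negP; apply.
apply: lt_le_trans wle.
have -> : x - (x + t *: (x + w - x)) = (- t) *: w.
  by apply/rowP => i; rewrite !mxE; ring.
rewrite enormZ normrN ger0_norm// gtr_pMl//.
rewrite lt_neqAle enorm_ge0 andbT eq_sym; apply/eqP => /enorm_eq0 w0.
by apply: ncl; rewrite w0 addr0; exact: subset_closure.
Qed.

End ConvexSets.

(** * Meshes inscribed in a domain *)

Section MeshInDomain.
Variables (R : realType) (d : nat) (Omega : set 'rV[R]_d) (T : mesh R d).
Hypotheses (d_gt0 : (0 < d)%N) (bounded_Omega : bounded_set Omega).
Hypothesis T_Omega : mesh_of T Omega.
Implicit Types (i j : 'I_(mesh_card T)).

Let T_sub : mesh_domain T `<=` Omega. Proof. by case: T_Omega. Qed.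

Let T_open : open (mesh_domain T). Proof. exact: open_interior. Qed.

Lemma closure_mesh_domain_sub : closure (mesh_domain T) `<=` closure Omega.
Proof. exact: closureS. Qed.

Lemma node_closure_Omega i : closure Omega (node i).
Proof. exact/closure_mesh_domain_sub/node_closure. Qed.

(** With an empty boundary the local scales would vanish, as inf set0 = 0. *)
Lemma mesh_boundary_nonempty : boundary (mesh_domain T) !=set0.
Proof.
apply: boundary_nonempty => //; last exact: mesh_domain_nonempty.
have [M [Mr MO]] := bounded_Omega; exists M; split => // x Mx y /T_sub.
exact: MO.
Qed.

Lemma interior_node_mesh_domain i : interior_node Omega i -> mesh_domain T (node i).
Proof.
move=> ni; apply: contrapT => nT; apply: ni; case: T_Omega => _ _; apply.
by split; [exact: node_closure|rewrite (interior_id _).1].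
Qed.

Lemma local_scale_gt0 delta i :
  0 < delta -> interior_node Omega i -> 0 < local_scale delta i.
Proof.
move=> delta0 ni; rewrite /local_scale lt_min delta0/=.
have /nbhs_ballP[e /= e0 eT] : nbhs (node i) (mesh_domain T).
  by apply: open_nbhs_nbhs; split => //; exact: interior_node_mesh_domain.
apply: lt_le_trans e0 (le_euclid_dist mesh_boundary_nonempty _) => y yb.
apply: le_trans (norm_le_enorm _); rewrite leNgt; apply/negP => lt_e.
by apply: (open_boundaryN T_open yb); apply: eT; rewrite -ball_normE.
Qed.

Lemma stencil_closure delta i (v : 'rV[R]_d) :
  0 < delta -> interior_node Omega i -> enorm v = 1 ->
  closure (mesh_domain T) (node i + local_scale delta i *: v) /\
  closure (mesh_domain T) (node i - local_scale delta i *: v).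
Proof.
move=> delta0 ni v1; have ls0 := local_scale_gt0 delta0 ni.
have Ti := interior_node_mesh_domain ni.
have le_dist : local_scale delta i <= euclid_dist (node i) (boundary (mesh_domain T)).
  by rewrite ge_min lexx orbT.
split; last rewrite -scaleNr; apply: closure_of_lt_dist => //.
  by rewrite enormZ v1 mulr1 gtr0_norm.
by rewrite enormZ v1 mulr1 normrN gtr0_norm.
Qed.

(** If all vertices of a simplex containing z were in the open convex mesh
    domain, so would be z. *)
Lemma boundary_node_near z : boundary (mesh_domain T) z ->
  exists2 j : 'I_(mesh_card T), boundary_node Omega j & enorm (z - node j) <= mesh_size T.
Proof.
move=> bz; have [s sT sz] := closure_mesh_domain_simplex bz.1.
have [j js bj] : exists2 j : 'I_(mesh_card T), j \in s & boundary (mesh_domain T) (node j).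
  apply: contrapT => nb; apply: (open_boundaryN T_open bz).
  have [a [a0 a1 ->]] := sz.
  rewrite -big_enum/=; apply: segment_closed_sum.
  - by apply: convex_set_segment_closed; case: T_Omega.
  - by move=> i _.
  - move=> i; rewrite mem_enum => si; apply: contrapT => nTi; apply: nb.
    exists i => //; split; first exact: node_closure.
    by rewrite (interior_id _).1.
  - by rewrite big_enum.
exists j; first by case: T_Omega => _ _; apply.
by apply: enorm_le_mesh_size sz _ => //; exact: vertex_hull.
Qed.

(** The mesh may fill only part of Omega, yet its boundary stays within one
    mesh size of that of Omega; so a node far from the complement of Omega is
    also far from the boundary of the mesh domain. *)
Lemma local_scale_full delta (r : R) i : open Omega ->
  mesh_size T + delta <= r -> (forall b, ~ Omega b -> r <= `|node i - b|) ->
  local_scale delta i = delta.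
Proof.
move=> oO hr rle; apply/min_idPl/le_euclid_dist; first exact: mesh_boundary_nonempty.
move=> z /boundary_node_near[j bj zj].
have := rle _ (open_boundaryN oO bj).
have : `|node i - node j| <= `|node i - z| + `|z - node j|.
  by rewrite -[node i - node j](subrKA z) ler_normD.
have := norm_le_enorm (node i - z); have := norm_le_enorm (z - node j); lra.
Qed.

End MeshInDomain.
(** * Comparison with the discrete solution *)

Lemma bigmin_seq_attained (R : realType) (V : eqType) (g : V -> R) (x0 m : R) (s : seq V) :
  \big[Num.min/x0]_(v <- s) g v = m ->
  [/\ m <= x0, forall v, v \in s -> m <= g v &
      x0 = m \/ exists2 v, v \in s & g v = m].
Proof.
elim: s m => [|w s IH] m; first by rewrite big_nil => ->; split => //; left.
rewrite big_cons; have [le_x0 le_g eq_m] := IH _ erefl.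
set m' := \big[Num.min/x0]_(v <- s) g v in le_x0 le_g eq_m *.
move=> <-; split.
- by rewrite ge_min le_x0 orbT.
- move=> v; rewrite inE ge_min => /predU1P[->|/le_g ->]; first by rewrite lexx.
  by rewrite orbT.
- have [_|_] := leP (g w) m'; first by right; exists w; rewrite ?mem_head.
  case: eq_m => [->|[v vs gv]]; [by left|right; exists v => //].
  by rewrite inE vs orbT.
Qed.

Section Comparison.
Variables (R : realType) (d : nat) (Omega : set 'rV[R]_d) (f : 'rV[R]_d -> R).
Variables (T : mesh R d) (delta theta : R) (Stheta : seq 'rV[R]_d).
Variable u : 'rV[R]_d -> R.
Hypotheses (d_gt0 : (0 < d)%N) (open_Omega : open Omega).
Hypotheses (bounded_Omega : bounded_set Omega) (T_Omega : mesh_of T Omega).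
Hypotheses (delta_gt0 : 0 < delta) (net : direction_net theta Stheta).
Hypothesis u_sol : discrete_solution T Omega f delta Stheta u.
Variable Q : R.
Hypothesis sqnorm_le_Q : forall y, closure Omega y -> sqnorm y <= Q.

Let cO (i : 'I_(mesh_card T)) : closure Omega (node i).
Proof. exact: node_closure_Omega T_Omega i. Qed.

Implicit Types i j k : 'I_(mesh_card T).

Lemma sqnorm_bound_ge0 : 0 <= Q.
Proof.
have [x Tx] := mesh_domain_nonempty T.
apply: le_trans (sqnorm_ge0 x) (sqnorm_le_Q _).
by apply: (closure_mesh_domain_sub T_Omega); exact: subset_closure.
Qed.

Lemma discrete_solution_le_obstacle i : u (node i) <= f (node i).
Proof.
case: u_sol => _ int bdr; have [/bdr->//|ni] := pselect (boundary_node Omega i).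
by have [+ _ _] := bigmin_seq_attained (int i ni); rewrite subr_ge0.
Qed.

(** Discrete comparison principle.  Adding s * (sqnorm x - Q) keeps l below f
    and makes it strictly convex.  At a node k where g - u is maximal and
    positive, u is strictly below f, so a second difference of u vanishes.  The
    excess g - u is also at most its maximum at the two stencil points, because
    u averages its nodal values and g, being convex, lies below the average of
    its own; so a second difference of g is at most 0, which strict convexity
    forbids. *)
Lemma discrete_solution_ge_affine (l : 'rV[R]_d -> R) x :
  affine l -> (forall y, closure Omega y -> l y <= f y) ->
  closure (mesh_domain T) x -> l x <= u x.
Proof.
move=> al lf cx; have [upl uint ubdr] := u_sol.
suff node_le i : l (node i) <= u (node i).
  have [a [a0 a1 xE -> _]] := piecewise_linear_average upl cx.
  by rewrite xE affine_average//; apply: ler_sum => i _; rewrite ler_wpM2l.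
apply/ler_addgt0Pr => e e0.
have Q0 := sqnorm_bound_ge0.
pose s := e / (Q + 1).
have s0 : 0 < s by rewrite divr_gt0// ltr_wpDl.
have sQ : s * Q <= e.
  by rewrite /s mulrAC ler_pdivrMr ?ltr_wpDl// ler_pM2l// lerDl.
pose g x := l x + s * (sqnorm x - Q).
suff g_le j : g (node j) <= u (node j).
  have := g_le i; rewrite /g.
  have : 0 <= s * sqnorm (node i) by rewrite mulr_ge0 ?sqnorm_ge0// ltW.
  by move: sQ; lra.
have gl k : g (node k) <= l (node k).
  by rewrite /g gerDl mulr_ge0_le0 ?subr_le0 ?sqnorm_le_Q// ltW.
have [k _ kmax] := @Order.TotalTheory.arg_maxP _ _ _ i xpredT
  (fun k => g (node k) - u (node k)) isT.
set M := g (node k) - u (node k) in kmax.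
have [M0|M0] := leP M 0.
  by have := kmax j isT; rewrite -subr_le0 => /le_trans; apply.
exfalso.
have guk : u (node k) < g (node k) by rewrite -subr_gt0.
have nk : interior_node Omega k.
  move=> bk; move: guk; rewrite ubdr// ltNge => /negP; apply.
  exact: (le_trans (gl k) (lf _ (@cO k))).
have [_ _ [fu|[v vS sd0]]] := bigmin_seq_attained (uint k nk).
  move: guk; rewrite ltNge => /negP; apply; apply: le_trans (gl k) _.
  by apply: (le_trans (lf _ (@cO k))); rewrite -subr_le0 fu.
have v1 : enorm v = 1 := net.1 v vS.
have ls0 := local_scale_gt0 d_gt0 bounded_Omega T_Omega delta_gt0 nk.
have [cp cm] := stencil_closure d_gt0 bounded_Omega T_Omega delta_gt0 nk v1.
(* Interpolating a convex function only increases it. *)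
have below z : closure (mesh_domain T) z -> g z - M <= u z.
  move=> cz; have [a [a0 a1 zE -> _]] := piecewise_linear_average upl cz.
  apply: (@le_trans _ _ (\sum_i a i * (g (node i) - M))); last first.
    apply: ler_sum => i' _; rewrite ler_wpM2l//.
    by have := kmax i' isT; rewrite /=; lra.
  under [leRHS]eq_bigr do rewrite /g mulrBr mulrDr mulrCA mulrBr.
  rewrite sumrB -mulr_suml a1 mul1r lerB// big_split/=.
  rewrite -affine_average// -zE lerD2l -mulr_sumr ler_pM2l// sumrB.
  by rewrite -mulr_suml a1 mul1r lerB// sqnorm_jensen.
have := lerD (below _ cp) (below _ cm).
move: sd0; rewrite /second_diff; set h := local_scale delta k.
move/eqP; rewrite mulf_eq0 invr_eq0 expf_eq0/= (gt_eqF ls0) orbF => /eqP sd0.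
have lsum : l (node k + h *: v) + l (node k - h *: v) = 2 * l (node k).
  case: al => p [c lE]; rewrite !lE !mulrDr mulr_sumr addrACA -big_split/=.
  by congr (_ + _); [apply: eq_bigr => i' _; rewrite !mxE; ring|ring].
have := sqnorm_parallelogram (node k) (h *: v).
rewrite sqnormZ -(sqr_enorm v) v1 expr1n mulr1 => sqsum.
have : 0 < s * h ^+ 2 by rewrite mulr_gt0// exprn_gt0.
have : s * (sqnorm (node k + h *: v) + sqnorm (node k - h *: v)) =
  s * (2 * sqnorm (node k) + 2 * h ^+ 2) by rewrite sqsum.
move: M0 sd0 lsum; rewrite /M /g.
move: (sqnorm (_ + _)) (sqnorm (_ - _)) (sqnorm _) (h ^+ 2) => A B C H.
by lra.
Qed.

(** The parameters are chosen in this order: e is the accuracy; C, the slope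
    in the modulus of f at accuracy e / 8; c, the half-length provided by
    graph_hull_split; r, the distance to the boundary that chords of half-length
    c guarantee; then the penalty parameter t and the weight s of the
    strictness term.  Only afterwards are delta, theta and the mesh size made
    small. *)
Section UpperBound.
Variables (F C e r t s : R).
Hypothesis closure_segment : segment_closed (closure Omega).
Hypothesis f_bound : forall y, closure Omega y -> `|f y| <= F.
Hypotheses (e_gt0 : 0 < e) (C_gt0 : 0 < C) (r_gt0 : 0 < r).
Hypotheses (t_gt0 : 0 < t) (s_gt0 : 0 < s).
Hypothesis f_modulus : forall x y, closure Omega x -> closure Omega y ->
  `|f x - f y| <= e / 8 + C * `|x - y|.
Let c := (e / 4) / (4 * C * d%:R).
Hypothesis midpoint : forall y E b,
  closure Omega (y + E) -> closure Omega (y - E) -> c <= `|E| -> ~ Omega b ->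
  r <= `|y - b|.
Hypotheses (t_small_C : C ^+ 2 * t <= e / 4) (t_small_F : 4 * t * F <= (r / 2) ^+ 2).
Hypothesis s_small : s * Q <= e / 8.
Hypotheses (delta_small : mesh_size T + delta <= r / 2) (delta_le_c : delta <= c).
Hypothesis consistency :
  theta ^+ 2 * delta ^+ 2 + mesh_size T ^+ 2 <= s * t * delta ^+ 2.

(** Doubling of variables.  Suppose that the supremum S of
    Phi i y v = u (node i) - v - |node i - y|^2 / (2 t) + s |node i|^2 exceeds
    e, and take a near maximiser.  As u is at most f at the nodes, v is below
    f y by more than e / 4, so graph_hull_split gives a chord of the hull
    through (y, v); its length keeps y, hence node i, away from the boundary,
    and the stencil at node i has the full size delta.  Shift node i by
    delta w and - delta w, where w is the direction of the net closest to the
    chord, and y by the corresponding amounts along the chord.  Since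
    Phi is at most S at the shifted pairs, averaged over nodes, and since the
    second difference of u is nonnegative, the loss 2 s delta^2 in the
    strictness term must be covered by the errors of direction and
    interpolation, at most (theta^2 delta^2 + h^2) / t: a contradiction. *)
Lemma discrete_solution_le_hull i y v : graph_hull (closure Omega) f y v ->
  u (node i) <= v + sqnorm (node i - y) / (2 * t) + e.
Proof.
move: i y v => i0 y0 v0 hull0; rewrite leNgt; apply/negP => contra.
have [upl uint ubdr] := u_sol.
have t2 : 0 < 2 * t by rewrite mulr_gt0.
pose Phi i y v := u (node i) - v - sqnorm (node i - y) / (2 * t) + s * sqnorm (node i).
pose V := [set p | exists i y v, graph_hull (closure Omega) f y v /\ p = Phi i y v].
have sN i : 0 <= s * sqnorm (node i) <= e / 8.
  rewrite mulr_ge0 ?sqnorm_ge0 ?(ltW s_gt0)//=; apply: le_trans s_small.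
  by rewrite ler_pM2l// sqnorm_le_Q.
have N0 (x y : 'rV[R]_d) : 0 <= sqnorm (x - y) / (2 * t) by rewrite divr_ge0 ?sqnorm_ge0// ltW.
have F_lo z : closure Omega z -> - F <= f z by move=> /f_bound; rewrite ler_norml => /andP[].
have F_hi z : closure Omega z -> f z <= F by move=> /f_bound; rewrite ler_norml => /andP[].
have supV : has_sup V.
  split; first by exists (Phi i0 y0 v0), i0, y0, v0.
  exists (2 * F + e / 8) => _ [i [y [v [hyv ->]]]]; rewrite /Phi.
  have := graph_hull_ge F_lo hyv; have := F_hi _ (@cO i).
  have := discrete_solution_le_obstacle i; have := N0 (node i) y.
  by have /andP[] := sN i; lra.
pose S := sup V.
have le_S i y v : graph_hull (closure Omega) f y v -> Phi i y v <= S.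
  by move=> hyv; apply: sup_upper_bound => //; exists i, y, v.
have S_gt : e < S.
  apply: lt_le_trans (le_S i0 _ _ hull0); rewrite /Phi.
  by have /andP[+ _] := sN i0; move: contra; lra.
have sd0 : 0 < s * delta ^+ 2 by rewrite mulr_gt0// exprn_gt0.
(* The defect of maximality must be small against the strictness gained over a
   stencil, and keep Phi above 3 e / 4. *)
pose rho := Num.min (e / 4) (s * delta ^+ 2 / 4).
have rho0 : 0 < rho by rewrite lt_min !divr_gt0.
have rho1 : rho <= e / 4 by rewrite ge_min lexx.
have rho2 : rho <= s * delta ^+ 2 / 4 by rewrite ge_min lexx orbT.
have [_ [i [y [v [hyv ->]]]] near_max] := sup_adherent rho0 supV.
rewrite -/S in near_max.
have Oy := graph_hull_base closure_segment hyv.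
have u_le_f := discrete_solution_le_obstacle i.
have v_ge := graph_hull_ge F_lo hyv.
have gap : 5 / 8 * e <= f (node i) - v - sqnorm (node i - y) / (2 * t).
  by move: near_max; rewrite /Phi; have /andP[] := sN i; lra.
have norm_sq : `|node i - y| ^+ 2 <= sqnorm (node i - y).
  by rewrite -sqr_enorm lerXn2r ?nnegrE ?enorm_ge0 ?norm_le_enorm.
(* Young's inequality, in the form (C t - |node i - y|)^2 >= 0. *)
have young : C * `|node i - y| <= e / 8 + sqnorm (node i - y) / (2 * t).
  have : 0 <= (C * t - `|node i - y|) ^+ 2 / (2 * t).
    by rewrite divr_ge0 ?sqr_ge0// ltW.
  have : `|node i - y| ^+ 2 / (2 * t) <= sqnorm (node i - y) / (2 * t).
    by rewrite ler_pM2r ?invr_gt0.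
  have -> : (C * t - `|node i - y|) ^+ 2 / (2 * t) =
      C ^+ 2 * t / 2 - C * `|node i - y| + `|node i - y| ^+ 2 / (2 * t).
    by field; rewrite gt_eqF.
  by move: t_small_C; lra.
have v_lt : v < f y - e / 4.
  have := f_modulus (@cO i) Oy; rewrite ler_norml => /andP[_].
  by move: gap young e_gt0; lra.
have e4 : 0 < e / 4 by rewrite divr_gt0.
have modf z : closure Omega z -> f y - (e / 4) / 2 - C * `|z - y| <= f z.
  move=> Oz; have := f_modulus Oy Oz; rewrite distrC (distrC y) ler_norml => /andP[].
  by lra.
have [E cE split_hull] := graph_hull_split closure_segment e4 C_gt0 modf hyv v_lt.
(* The whole chord, tau = 1, for the distance to the boundary; below, tau is
   chosen so that the shift of y has length delta. *)
have y_far b : ~ Omega b -> r <= `|y - b|.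
  move=> nOb.
  have h01 : 0 <= (1 : R) <= 1 by rewrite ler01 /=.
  have [vp [vm [_ hp hm]]] := split_hull _ h01.
  by apply: (@midpoint y E) => //; rewrite -[E]scale1r;
    [exact: graph_hull_base hp|exact: graph_hull_base hm].
have xy_close : `|node i - y| <= r / 2.
  rewrite -(@ler_pXn2r _ 2) ?nnegrE ?divr_ge0 ?(ltW r_gt0)//.
  apply: le_trans norm_sq _; apply: le_trans t_small_F.
  have : sqnorm (node i - y) / (2 * t) <= 2 * F.
    by have := F_hi _ (@cO i); move: gap e_gt0 v_ge; lra.
  by rewrite ler_pdivrMr//; lra.
have x_far b : ~ Omega b -> r / 2 <= `|node i - b|.
  move=> /y_far; have : `|y - b| <= `|y - node i| + `|node i - b|.
    by rewrite -[y - b](subrKA (node i)) ler_normD.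
  by rewrite (distrC y (node i)); move: xy_close; lra.
have ni : interior_node Omega i.
  move=> /(open_boundaryN open_Omega)/x_far; rewrite subrr normr0.
  by move: r_gt0; lra.
have ls : local_scale delta i = delta.
  exact: (local_scale_full d_gt0 bounded_Omega T_Omega open_Omega delta_small x_far).
have c_gt0 : 0 < c.
  by rewrite divr_gt0// mulr_gt0 ?ltr0n// mulr_gt0.
have E_gt0 : 0 < enorm E by apply: lt_le_trans c_gt0 (le_trans cE (norm_le_enorm E)).
pose E1 := (enorm E)^-1 *: E.
have E11 : enorm E1 = 1.
  by rewrite enormZ ger0_norm ?invr_ge0 ?(ltW E_gt0)// mulVf// gt_eqF.
have [w wS E1w] := net.2 _ E11.
have w1 : enorm w = 1 := net.1 w wS.
have tau01 : 0 <= delta / enorm E <= 1.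
  rewrite divr_ge0 ?(ltW E_gt0) ?(ltW delta_gt0)//= ler_pdivrMr// mul1r.
  by apply: le_trans delta_le_c (le_trans cE (norm_le_enorm E)).
have [vp [vm [vpm hp hm]]] := split_hull _ tau01.
have [cp cm] := stencil_closure d_gt0 bounded_Omega T_Omega delta_gt0 ni w1.
rewrite ls in cp cm.
(* Phi <= S at every node, averaged with the interpolation weights of z. *)
have above z q a : closure (mesh_domain T) z -> graph_hull (closure Omega) f q a ->
    u z <= S + a + (sqnorm (z - q) + mesh_size T ^+ 2) / (2 * t) - s * sqnorm z.
  move=> cz hqa; have [b [b0 b1 zE -> bh]] := piecewise_linear_average upl cz.
  apply: (@le_trans _ _ (\sum_j b j * (S + a +
      sqnorm (node j - q) / (2 * t) - s * sqnorm (node j)))).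
    apply: ler_sum => j _; rewrite ler_wpM2l//.
    by have := le_S j _ _ hqa; rewrite /Phi; lra.
  have -> : \sum_j b j * (S + a + sqnorm (node j - q) / (2 * t) - s * sqnorm (node j)) =
      S + a + (\sum_j b j * sqnorm (node j - q)) / (2 * t) -
      s * \sum_j b j * sqnorm (node j).
    transitivity ((\sum_j b j) * (S + a) +
        (\sum_j b j * sqnorm (node j - q)) / (2 * t) -
        s * \sum_j b j * sqnorm (node j)); last by rewrite b1 mul1r.
    rewrite !mulr_suml mulr_sumr -big_split/= -sumrB.
    by apply: eq_bigr => j _; ring.
  rewrite (sqnorm_average q b1 zE); apply: lerB.
    by rewrite lerD2l ler_pM2r ?invr_gt0// lerD2l.
  by rewrite ler_pM2l// sqnorm_jensen.
have Up := above _ _ _ cp hp; have Um := above _ _ _ cm hm.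
have [_ sd_ge _] := bigmin_seq_attained (uint i ni).
have := sd_ge w wS; rewrite /second_diff ls.
rewrite pmulr_lge0 ?invr_gt0 ?exprn_gt0// => sd.
pose A := node i - y; pose B := delta *: (w - E1).
have tauE : (delta / enorm E) *: E = delta *: E1 by rewrite scalerA.
have pE : node i + delta *: w - (y + (delta / enorm E) *: E) = A + B.
  by rewrite tauE; apply/rowP => k; rewrite !mxE; ring.
have mE : node i - delta *: w - (y - (delta / enorm E) *: E) = A - B.
  by rewrite tauE; apply/rowP => k; rewrite !mxE; ring.
have AB := sqnorm_parallelogram A B.
have B_le : sqnorm B <= theta ^+ 2 * delta ^+ 2.
  rewrite sqnormZ mulrC ler_pM2r ?exprn_gt0// sqnormBC -sqr_enorm.
  by rewrite lerXn2r ?nnegrE ?enorm_ge0// (le_trans (enorm_ge0 _) E1w).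
have W := sqnorm_parallelogram (node i) (delta *: w).
rewrite sqnormZ -(sqr_enorm w) w1 expr1n mulr1 in W.
have error : (sqnorm B + mesh_size T ^+ 2) / t <= s * delta ^+ 2.
  by rewrite ler_pdivrMr// mulrAC; apply: le_trans consistency; rewrite lerD2r.
rewrite pE in Up; rewrite mE in Um.
have sW : s * sqnorm (node i + delta *: w) + s * sqnorm (node i - delta *: w) =
    2 * (s * sqnorm (node i)) + 2 * (s * delta ^+ 2).
  by rewrite -mulrDr W; ring.
have sAB : (sqnorm (A + B) + mesh_size T ^+ 2) / (2 * t) +
           (sqnorm (A - B) + mesh_size T ^+ 2) / (2 * t) =
    2 * (sqnorm A / (2 * t)) + (sqnorm B + mesh_size T ^+ 2) / t.
  rewrite -mulrDl addrACA AB; field; by rewrite gt_eqF.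
move: near_max; rewrite /Phi -/A.
by move: Up Um sd vpm sW sAB error rho2 sd0; lra.
Qed.

End UpperBound.
End Comparison.
Lemma compact_continuous_bounded (R : realType) d (K : set 'rV[R]_d) (f : 'rV[R]_d -> R) :
  compact K -> {within K, continuous f} ->
  exists2 F : R, 0 < F & forall x, K x -> `|f x| <= F.
Proof.
move=> cK cf; have [M [Mr MK]] := compact_bounded (continuous_compact cf cK).
exists (Num.max M 0 + 1); first by rewrite ltr_wpDl// le_max lexx orbT.
move=> x Kx; apply: (MK (Num.max M 0 + 1)); last by exists x.
by rewrite (@le_lt_trans _ _ (Num.max M 0)) ?le_max ?lexx// ltrDl.
Qed.

(** * Convergence *)

Lemma direction_net_ge0 (R : realType) d (theta : R) (Stheta : seq 'rV[R]_d) :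
  (0 < d)%N -> direction_net theta Stheta -> 0 <= theta.
Proof.
move=> d0 [_ net]; pose v : 'rV[R]_d := delta_mx 0 (Ordinal d0).
have v1 : enorm v = 1.
  rewrite /enorm (bigD1 (Ordinal d0))//= big1 => [|i /negbTE i0].
    by rewrite mxE !eqxx expr1n addr0 sqrtr1.
  by rewrite mxE i0 andbF expr0n.
by have [w _] := net v v1; apply: le_trans; exact: enorm_ge0.
Qed.

Theorem theorem2p6 (R : realType) (d : nat) (Omega : set 'rV[R]_d)
    (f : 'rV[R]_d -> R) (T : nat -> mesh R d) :
  (0 < d)%N ->
  Omega !=set0 -> open Omega -> bounded_set Omega -> strictly_convex Omega ->
  {within closure Omega, continuous f} ->
  (forall k, mesh_of (T k) Omega) -> shape_regular T -> quasi_uniform T ->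
  forall eta : R, 0 < eta ->
  exists2 kappa : R, 0 < kappa &
    forall (k : nat) (delta theta : R) (Stheta : seq 'rV[R]_d)
           (u_eps : 'rV[R]_d -> R),
      mesh_size (T k) <= delta -> direction_net theta Stheta ->
      mesh_size (T k) < kappa -> delta < kappa -> theta < kappa ->
      mesh_size (T k) / delta < kappa ->
      discrete_solution (T k) Omega f delta Stheta u_eps ->
      (Linfty_norm (mesh_domain (T k))
         (fun x => (u_eps x - convex_envelope Omega f x)%R) < eta%:E)%E.
Proof.
move=> d0 [x0 Ox0] oO bO sO cf TO _ _ eta eta0.
have [D D0 OD] := closure_norm_le bO.
have cO : compact (closure Omega).
  apply: bounded_closed_compact; last exact: closed_closure.
  by exists D; split; [exact: num_real|move=> M DM y /OD/le_trans; apply; exact: ltW].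
have segO := strictly_convex_segment_closed sO.
have [F F0 fF] := compact_continuous_bounded cO cf.
pose e := eta / 4; have e0 : 0 < e by rewrite divr_gt0.
have e80 : 0 < e / 8 by rewrite divr_gt0.
have [C C0 modC] := compact_linear_modulus cO cf e80 fF.
have dR0 : 0 < d%:R :> R by rewrite ltr0n.
pose c := (e / 4) / (4 * C * d%:R).
have c0 : 0 < c by rewrite !divr_gt0// !mulr_gt0.
have [r r0 mid] := strictly_convex_midpoint oO cO sO c0.
pose Q := d%:R * D ^+ 2.
have OQ y : closure Omega y -> sqnorm y <= Q by move=> /OD; exact: sqnorm_le_norm.
have Q0 : 0 <= Q by rewrite mulr_ge0 ?sqr_ge0// ltW.
pose t := Num.min (e / 4 / C ^+ 2) ((r / 2) ^+ 2 / (4 * F)).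
have t0 : 0 < t by rewrite lt_min !divr_gt0 ?exprn_gt0 ?mulr_gt0 ?divr_gt0.
have tC : C ^+ 2 * t <= e / 4.
  by rewrite mulrC -ler_pdivlMr ?exprn_gt0// ge_min lexx.
have tF : 4 * t * F <= (r / 2) ^+ 2.
  by rewrite mulrAC mulrC -ler_pdivlMr ?mulr_gt0// ge_min lexx orbT.
pose s := e / 8 / (Q + 1).
have Q1 : 0 < Q + 1 by rewrite ltr_wpDl.
have s0 : 0 < s by rewrite divr_gt0.
have sQ : s * Q <= e / 8.
  by rewrite /s mulrAC ler_pdivrMr// ler_pM2l// lerDl.
(* In turn: the stencils reach neither the boundary layer nor the ends of the
   chords; theta^2 and (h / delta)^2 are at most s t / 2; h^2 <= 2 t e.  The
   bound by 1 turns the last conditions, on squares, into linear ones. *)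
pose kappa := Num.min (Num.min (r / 4) c)
  (Num.min (Num.min 1 (s * t / 2)) (2 * t * e)).
have st0 : 0 < s * t / 2 by rewrite divr_gt0// mulr_gt0.
exists kappa.
  by rewrite !lt_min c0 ltr01 st0 divr_gt0// !mulr_gt0.
have lt_kappa (z : R) : z < kappa ->
    [/\ z < r / 4, z < c, z < 1, z < s * t / 2 & z < 2 * t * e].
  by rewrite !lt_min => /andP[/andP[-> ->] /andP[/andP[-> ->] ->]].
have sqr_small (z b : R) : 0 <= z -> z < 1 -> z < b -> z ^+ 2 <= b.
  move=> z0 z1 zb; apply: le_trans (ltW zb).
  by rewrite expr2 ler_piMl// ltW.
move=> k delta theta Stheta u le_delta net.
set h := mesh_size (T k).
move=> /lt_kappa[h_r _ h1 _ h_t] /lt_kappa[delta_r delta_c _ _ _].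
move=> /lt_kappa[_ _ theta1 theta_st _] /lt_kappa[_ _ hd1 hd_st _] sol.
have h0 : 0 < h by exact: mesh_size_gt0.
have delta0 : 0 < delta by apply: lt_le_trans le_delta.
have theta0 := direction_net_ge0 d0 net.
have consistency : theta ^+ 2 * delta ^+ 2 + h ^+ 2 <= s * t * delta ^+ 2.
  have -> : h = h / delta * delta by rewrite divfK// gt_eqF.
  rewrite exprMn -mulrDl ler_pM2r ?exprn_gt0//.
  have := sqr_small _ _ theta0 theta1 theta_st.
  have hd0 : 0 <= h / delta by rewrite divr_ge0// ltW.
  by have := sqr_small _ _ hd0 hd1 hd_st; lra.
have h_delta : h + delta <= r / 2 by move: h_r delta_r; lra.
have h2 : h ^+ 2 / (2 * t) <= e.
  by rewrite ler_pdivrMr ?mulr_gt0// mulrC; exact: sqr_small (ltW h0) h1 h_t.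
have node_le := discrete_solution_le_hull d0 oO bO (TO k) delta0 net sol OQ
  segO fF e0 C0 r0 t0 s0 modC mid tC tF sQ h_delta (ltW delta_c) consistency.
have pl : piecewise_linear (T k) u by case: sol.
apply: (@le_lt_trans _ _ (eta / 2)%:E); last first.
  by rewrite lte_fin; lra.
apply: ge_ereal_sup => _ [x Tx <-]; rewrite lee_fin.
have cx : closure (mesh_domain (T k)) x by exact: subset_closure.
have Ox : closure Omega x by exact: (closure_mesh_domain_sub (TO k)).
have lower : convex_envelope Omega f x <= u x.
  apply: (@convex_envelope_le _ _ _ _ (- F)).
    by move=> y /fF; rewrite ler_norml => /andP[].
  move=> l al lf.
  exact: (discrete_solution_ge_affine d0 bO (TO k) delta0 net sol OQ al lf cx).
have upper : u x - e - h ^+ 2 / (2 * t) <= convex_envelope Omega f x.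
  apply: (le_convex_envelope segO OD t0 Ox) => y v hyv.
  have [a [a0 a1 xE -> ah]] := piecewise_linear_average pl cx.
  have : \sum_i a i * u (node i) <=
      \sum_i a i * (v + sqnorm (node i - y) / (2 * t) + e).
    by apply: ler_sum => i _; rewrite ler_wpM2l// node_le.
  have -> : \sum_i a i * (v + sqnorm (node i - y) / (2 * t) + e) =
      v + e + (\sum_i a i * sqnorm (node i - y)) / (2 * t).
    transitivity ((\sum_i a i) * (v + e) +
        (\sum_i a i * sqnorm (node i - y)) / (2 * t)); last by rewrite a1 mul1r.
    by rewrite !mulr_suml -big_split/=; apply: eq_bigr => i _; ring.
  rewrite (sqnorm_average y a1 xE) mulrDl => le_v.
  have : (\sum_i a i * sqnorm (node i - x)) / (2 * t) <= h ^+ 2 / (2 * t).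
    by rewrite ler_pM2r// invr_gt0 mulr_gt0.
  by move: le_v; lra.
rewrite ger0_norm ?subr_ge0//.
by move: upper h2; rewrite /e; lra.
Qed.
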